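(* Let $\mathcal P$, $\mathcal M$, $(-)^*$ be data satisfying conditions (A1)–(A7) of the context, with associated category with zero morphisms $\mathcal D$ and kernel $M$. If $\mathcal X$ is a semiabelian category, then the functor $\widetilde M\colon[\mathcal P,\mathcal X]\to[\mathcal D,\mathcal X]_{\mathrm{pt}}$, right adjoint to $\widehat M$, is (crudely) monadic.
   Context: Setting. $\mathcal P$ is a category, $\mathcal M$ is a subcategory of $\mathcal P$ containing all isomorphisms of $\mathcal P$, and $(-)^*\colon\mathcal M^{\mathrm{op}}\to\mathcal P$ is a functor which is the identity on objects and satisfies $m^*\circ m=1$ for all $m\in\mathcal M$. For an object $A$, $\mathrm{Sub}A$ is the partially ordered set of isomorphism classes of morphisms $m\colon U\to A$ in $\mathcal M$, where $m\preceq n$ iff $m=n\circ f$ for some $f$. We write $U\preceq_m A$ for the element represented by $m\colon U\to A$, and $U\prec_m A$ (proper) if moreover $m$ is not invertible. $\mathcal R$ is the class of morphisms $r$ of $\mathcal P$ such that whenever $r=m\circ x\circ n^*$ with $m,n\in\mathcal M$, both $m$ and $n$ are invertible. $\mathcal S$ is the class of morphisms $r\circ m^*$ with $r\in\mathcal R$, $m\in\mathcal M$. Conditions: (A1) Every morphism $f$ of $\mathcal P$ factors as $f=n\circ r\circ m^*$ with $m,n\in\mathcal M$, $r\in\mathcal R$, and $m,n,r$ are unique up to isomorphism. (A2) If $r,r'\in\mathcal R$ are composable then $r'\circ r\in\mathcal S$. (A3) If $r\in\mathcal R$, $m\in\mathcal M$ and $m^*\circ r\in\mathcal R$, then $m$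 is invertible. (A4) The class of morphisms $m\circ n^*$ with $m,n\in\mathcal M$ is closed under composition. (A5) Each $\mathrm{Sub}A$ is finite. (A6) For each object $A$, the relation $R_A$ on $\mathrm{Sub}A$ given by $m\,R_A\,n$ iff $m^*\circ n\in\mathcal M$ is contained in an antisymmetric transitive relation on $\mathrm{Sub}A$. (A7) For each object $A$, the maximal proper elements of $\mathrm{Sub}A$ can be listed $m_1,\dots,m_n$ such that the idempotents $c_i=m_i\circ m_i^*$ on $A$ satisfy $c_j\circ c_i\circ c_j=c_j\circ c_i$ for all $i<j$. $1/\mathrm{Set}$ is the category of pointed sets with smash product $\wedge$; $\mathrm p\Lambda$ is the set $\Lambda$ with a base point $0$ freely added. $\mathcal D$ is the category with zero morphisms with the objects of $\mathcal P$ and $\mathcal D(A,B)=\mathrm p\{r\in\mathcal R\mid r\colon A\to B\}$; the composite in $\mathcal D$ of two morphisms of $\mathcal R$ is their composite in $\mathcal P$ if this lies in $\mathcal R$, and $0$ otherwise. $[\mathcal D,\mathcal X]_{\mathrm{pt}}$ is the category of zero-morphism-preserving functors; $[\mathcal P,\mathcal X]$ is the ordinary functor category. Each $u\colon A\to B$ in $\mathcal P$ factors, uniquely up to isomorphism, as $u=m_u\circ s_u$ with $s_u\in\mathcal S$, $m_u\in\mathcal M$. The kernel is $M(A,B)=\mathrm p\{u\in\mathcal P(A,B)\mid s_u\in\mathcal R\}$, with $M(r,f)u=f\circ u\circ r$ if $s_{fur}\in\mathcal R$ and $0$ otherwise. The adjunction $\widehat M\dashv\widetilde M$ is given by $\widehat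 M(F)B=\int^{A\in\mathcal D}M(A,B)\wedge FA$ and $\widetilde M(T)A=\int_B[M(A,B),TB]$ ($1/\mathrm{Set}$-enriched weighted colimit/limit); concretely $\widehat M(F)B\cong\sum_{S\preceq_m B}FS$ and $\widetilde M(T)A\cong\bigcap_{U\prec_m A}\ker T(m^*\colon A\to U)$, with $\widetilde M(T)r$ the restriction of $Tr$ for $r\in\mathcal R$. A functor is crudely monadic when it has a left adjoint, is conservative, its domain has reflexive coequalizers, and it preserves reflexive coequalizers. A category with zero morphisms is protomodular when it is finitely complete and, for each object $A$, the functor $\ker\colon\mathrm{Pt}A\to\mathcal X$ is conservative, where $\mathrm{Pt}A$ has objects $(p\colon X\to A,\ s\colon A\to X)$ with $p\circ s=1_A$ and morphisms the maps commuting with both $p$'s and $s$'s, and $\ker$ sends $(p,X,s)$ to the kernel of $p$. A category is semiabelian when it has zero morphisms, is protomodular, is Barr exact, and has finite coproducts. *)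

(* Defs.v *)
From Stdlib Require Import List Classical ClassicalEpsilon.
From Stdlib Require Import FunctionalExtensionality ProofIrrelevance.
Set Implicit Arguments.
Unset Strict Implicit.
Unset Printing Implicit Defensive.

Record category := Category {
  obj :> Type;
  hom : obj -> obj -> Type;
  idm : forall A, hom A A;
  comp : forall A B C, hom B C -> hom A B -> hom A C;
  comp_id_l : forall A B (f : hom A B), comp (idm B) f = f;
  comp_id_r : forall A B (f : hom A B), comp f (idm A) = f;
  comp_assoc : forall A B C D (h : hom C D) (g : hom B C) (f : hom A B),
    comp h (comp g f) = comp (comp h g) f }.
Arguments hom {c} A B.
Arguments idm {c} A.
Arguments comp {c A B C} g f.

Declare Scope cat_scope.
Open Scope cat_scope.
Notation "g ∘ f" := (comp g f) (at level 40, left associativity) : cat_scope.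

Definition is_iso (C : category) (A B : C) (f : hom A B) : Prop :=
  exists g : hom B A, g ∘ f = idm A /\ f ∘ g = idm B.

Record functor (C D : category) := Functor {
  fob :> C -> D;
  fmap : forall A B, hom A B -> hom (fob A) (fob B);
  fmap_id : forall A, fmap (idm A) = idm (fob A);
  fmap_comp : forall A B E (g : hom B E) (f : hom A B),
    fmap (g ∘ f) = fmap g ∘ fmap f }.
Arguments fmap {C D} _ {A B} _.

Record nat_trans (C D : category) (F G : functor C D) := NatTrans {
  nt_app :> forall A, hom (F A) (G A);
  naturality : forall A B (f : hom A B),
    nt_app B ∘ fmap F f = fmap G f ∘ nt_app A }.

Lemma nat_trans_eq (C D : category) (F G : functor C D) (s t : nat_trans F G) :
  (forall A, s A = t A) -> s = t.
Proof.
destruct s as [s sn], t as [t tn]; simpl; intros H.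
assert (E : s = t) by (apply functional_extensionality_dep; exact H).
subst t; f_equal; apply proof_irrelevance.
Qed.

Definition nat_id (C D : category) (F : functor C D) : nat_trans F F.
Proof.
exists (fun A => idm (F A)).
intros A B f; rewrite comp_id_l, comp_id_r; reflexivity.
Defined.

Definition nat_comp (C D : category) (F G H : functor C D)
  (t : nat_trans G H) (s : nat_trans F G) : nat_trans F H.
Proof.
exists (fun A => t A ∘ s A).
intros A B f.
rewrite <- comp_assoc, naturality, comp_assoc, naturality, comp_assoc.
reflexivity.
Defined.

Definition functor_cat (C D : category) : category.
Proof.
refine (@Category (functor C D) (@nat_trans C D) (@nat_id C D)
          (@nat_comp C D) _ _ _); intros; apply nat_trans_eq; intros; simpl.
- apply comp_id_l.
- apply comp_id_r.
- apply comp_assoc.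
Defined.

Definition adjoint (C D : category) (F : functor C D) (G : functor D C) : Prop :=
  exists (phi : forall (c : C) (d : D), hom (F c) d -> hom c (G d))
         (psi : forall (c : C) (d : D), hom c (G d) -> hom (F c) d),
    (forall c d f, psi c d (phi c d f) = f) /\
    (forall c d g, phi c d (psi c d g) = g) /\
    (forall c c' d d' (a : hom c' c) (b : hom d d') (f : hom (F c) d),
       phi c' d' (b ∘ f ∘ fmap F a) = fmap G b ∘ phi c d f ∘ a).

Definition conservative (C D : category) (F : functor C D) : Prop :=
  forall A B (f : hom A B), is_iso (fmap F f) -> is_iso f.

Definition finite_type (I : Type) : Prop := exists l : list I, forall i, In i l.

Definition finite_category (J : category) : Prop :=
  finite_type J /\ forall i j : J, finite_type (hom i j).

Definition is_cone (J C : category) (F : functor J C) (L : C)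
  (p : forall j, hom L (F j)) : Prop :=
  forall i j (a : hom i j), fmap F a ∘ p i = p j.

Definition is_limit (J C : category) (F : functor J C) (L : C)
  (p : forall j, hom L (F j)) : Prop :=
  is_cone p /\
  forall (Y : C) (q : forall j, hom Y (F j)), is_cone q ->
    exists! h : hom Y L, forall j, p j ∘ h = q j.

Definition finitely_complete (C : category) : Prop :=
  forall (J : category) (F : functor J C), finite_category J ->
    exists (L : C) (p : forall j, hom L (F j)), is_limit p.

Definition is_coproduct (C : category) (I : Type) (X : I -> C) (S : C)
  (i : forall k, hom (X k) S) : Prop :=
  forall (Y : C) (j : forall k, hom (X k) Y),
    exists! h : hom S Y, forall k, h ∘ i k = j k.

Definition has_finite_coproducts (C : category) : Prop :=
  forall (I : Type) (X : I -> C), finite_type I ->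
    exists (S : C) (i : forall k, hom (X k) S), is_coproduct i.

Definition is_coequalizer (C : category) (A B Q : C) (f g : hom A B)
  (q : hom B Q) : Prop :=
  q ∘ f = q ∘ g /\
  forall (Y : C) (h : hom B Y), h ∘ f = h ∘ g -> exists! k : hom Q Y, k ∘ q = h.

Definition is_pullback (C : category) (A B E Q : C) (f : hom A E) (g : hom B E)
  (p : hom Q A) (q : hom Q B) : Prop :=
  f ∘ p = g ∘ q /\
  forall (Y : C) (a : hom Y A) (b : hom Y B), f ∘ a = g ∘ b ->
    exists! h : hom Y Q, p ∘ h = a /\ q ∘ h = b.

Definition is_kernel_pair (C : category) (A B Q : C) (f : hom A B)
  (p q : hom Q A) : Prop := is_pullback f f p q.

Definition reflexive_pair (C : category) (A B : C) (f g : hom A B) : Prop :=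
  exists s : hom B A, f ∘ s = idm B /\ g ∘ s = idm B.

Definition has_reflexive_coequalizers (C : category) : Prop :=
  forall (A B : C) (f g : hom A B), reflexive_pair f g ->
    exists (Q : C) (q : hom B Q), is_coequalizer f g q.

Definition preserves_reflexive_coequalizers (C D : category)
  (G : functor C D) : Prop :=
  forall (A B Q : C) (f g : hom A B) (q : hom B Q), reflexive_pair f g ->
    is_coequalizer f g q -> is_coequalizer (fmap G f) (fmap G g) (fmap G q).

Definition crudely_monadic (C D : category) (G : functor C D) : Prop :=
  (exists F : functor D C, adjoint F G) /\
  conservative G /\
  has_reflexive_coequalizers C /\
  preserves_reflexive_coequalizers G.

Record zcategory := ZCategory {
  zcat :> category;
  zero : forall A B : zcat, hom A B;
  zero_l : forall (A B C : zcat) (f : hom A B), zero B C ∘ f = zero A C;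
  zero_r : forall (A B C : zcat) (f : hom B C), f ∘ zero A B = zero A C }.
Arguments zero {z} A B.

Record zfunctor (D X : zcategory) := ZFunctor {
  zfun :> functor D X;
  zfun_zero : forall A B : D, fmap zfun (zero A B) = zero (zfun A) (zfun B) }.

(* [D, X]_pt, as a full subcategory of [D, X] *)
Definition zfunctor_cat (D X : zcategory) : category.
Proof.
refine (@Category (zfunctor D X) (fun F G => nat_trans F G)
          (fun F => nat_id F) (fun F G H t s => nat_comp t s) _ _ _);
  intros; apply nat_trans_eq; intros; simpl.
- apply comp_id_l.
- apply comp_id_r.
- apply comp_assoc.
Defined.

Definition is_kernel (X : zcategory) (K A B : X) (p : hom A B) (k : hom K A) :
  Prop :=
  p ∘ k = zero K B /\
  forall (Y : X) (a : hom Y A), p ∘ a = zero Y B -> exists! h : hom Y K, k ∘ h = a.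

Record point (X : category) (A : X) := Point {
  pt_ob : X;
  pt_p : hom pt_ob A;
  pt_s : hom A pt_ob;
  pt_ps : pt_p ∘ pt_s = idm A }.

Definition point_hom (X : category) (A : X) (x y : point A) : Type :=
  { f : hom (pt_ob x) (pt_ob y) | pt_p y ∘ f = pt_p x /\ f ∘ pt_s x = pt_s y }.

Lemma sig_eq (T : Type) (Q : T -> Prop) (x y : sig Q) :
  proj1_sig x = proj1_sig y -> x = y.
Proof. apply eq_sig_hprop; intros; apply proof_irrelevance. Qed.

Definition Pt (X : category) (A : X) : category.
Proof.
refine (@Category (point A) (@point_hom X A)
  (fun x => exist _ (idm (pt_ob x)) _)
  (fun x y z g f => exist _ (proj1_sig g ∘ proj1_sig f) _) _ _ _).
Unshelve.
- intros; apply sig_eq, comp_id_l.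
- intros; apply sig_eq, comp_id_r.
- intros; apply sig_eq, comp_assoc.
- split; [apply comp_id_r | apply comp_id_l].
- destruct f as [f [f1 f2]], g as [g [g1 g2]]; simpl; split.
  + rewrite comp_assoc, g1; exact f1.
  + rewrite <- comp_assoc, f2; exact g2.
Defined.

(* K is the functor ker : Pt A -> X (determined up to isomorphism). *)
Definition is_kernel_functor (X : zcategory) (A : X) (K : functor (Pt A) X) :
  Prop :=
  exists k : forall x : Pt A, hom (K x) (pt_ob x),
    (forall x, is_kernel (pt_p x) (k x)) /\
    (forall (x y : Pt A) (f : hom x y), k y ∘ fmap K f = proj1_sig f ∘ k x).

Definition protomodular (X : zcategory) : Prop :=
  finitely_complete X /\
  forall A : X, exists K : functor (Pt A) X,
    is_kernel_functor K /\ conservative K.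

Definition regular_epi (C : category) (B Q : C) (q : hom B Q) : Prop :=
  exists (A : C) (f g : hom A B), is_coequalizer f g q.

Definition regular (C : category) : Prop :=
  finitely_complete C /\
  (forall (A B R : C) (f : hom A B) (p q : hom R A), is_kernel_pair f p q ->
     exists (Q : C) (c : hom A Q), is_coequalizer p q c) /\
  (forall (A B E Q : C) (f : hom A E) (g : hom B E) (p : hom Q A) (q : hom Q B),
     is_pullback f g p q -> regular_epi f -> regular_epi q).

(* Internal relations are read through generalized elements; joint monicity
   replaces a mono R -> A x A, so that no product has to be chosen. *)
Definition internal_rel (C : category) (R A : C) (r1 r2 : hom R A) (Y : C)
  (a b : hom Y A) : Prop := exists t : hom Y R, r1 ∘ t = a /\ r2 ∘ t = b.

Definition internal_equivalence (C : category) (R A : C) (r1 r2 : hom R A) :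
  Prop :=
  (forall (Y : C) (t u : hom Y R), r1 ∘ t = r1 ∘ u -> r2 ∘ t = r2 ∘ u -> t = u) /\
  forall Y : C,
    (forall a : hom Y A, internal_rel r1 r2 a a) /\
    (forall a b : hom Y A, internal_rel r1 r2 a b -> internal_rel r1 r2 b a) /\
    (forall a b c : hom Y A, internal_rel r1 r2 a b -> internal_rel r1 r2 b c ->
       internal_rel r1 r2 a c).

Definition Barr_exact (C : category) : Prop :=
  regular C /\
  forall (R A : C) (r1 r2 : hom R A), internal_equivalence r1 r2 ->
    exists (B : C) (f : hom A B), is_kernel_pair f r1 r2.

Definition semiabelian (X : zcategory) : Prop :=
  protomodular X /\ Barr_exact X /\ has_finite_coproducts X.

(* M contains all identities, hence is a predicate on morphisms only. Since the
   functor ( )^* is the identity on objects, it is given by its action on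
   morphisms. *)
Record star_data (P : category) := StarData {
  inM : forall A B : P, hom A B -> Prop;
  inM_iso : forall (A B : P) (f : hom A B), is_iso f -> inM f;
  inM_comp : forall (A B C : P) (g : hom B C) (f : hom A B),
    inM g -> inM f -> inM (g ∘ f);
  star : forall (A B : P) (m : hom A B), inM m -> hom B A;
  star_id : forall (A : P) (h : inM (idm A)), star h = idm A;
  star_comp : forall (A B C : P) (g : hom B C) (f : hom A B)
    (hg : inM g) (hf : inM f) (hgf : inM (g ∘ f)),
    star hgf = star hf ∘ star hg;
  star_mul : forall (A B : P) (m : hom A B) (h : inM m), star h ∘ m = idm A }.
Arguments inM {P} s {A B} f.
Arguments star {P s A B m} h.

Section Classes.
Variables (P : category) (S : star_data P).

Definition inR (A B : P) (r : hom A B) : Prop :=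
  forall (C D : P) (m : hom D B) (x : hom C D) (n : hom C A)
    (hm : inM S m) (hn : inM S n),
    r = m ∘ x ∘ star hn -> is_iso m /\ is_iso n.

Definition inS (A B : P) (f : hom A B) : Prop :=
  exists (C : P) (r : hom C B) (m : hom C A) (h : inM S m),
    inR r /\ f = r ∘ star h.

(* Elements of Sub A are given by representatives; equality in Sub A is
   [sub_iso]. *)
Record sub (A : P) := Sub {
  sub_dom : P;
  sub_mor : hom sub_dom A;
  sub_in : inM S sub_mor }.

Definition sub_le (A : P) (m n : sub A) : Prop :=
  exists f : hom (sub_dom m) (sub_dom n), sub_mor m = sub_mor n ∘ f.

Definition sub_iso (A : P) (m n : sub A) : Prop :=
  exists f : hom (sub_dom m) (sub_dom n), is_iso f /\ sub_mor m = sub_mor n ∘ f.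

Definition proper (A : P) (m : sub A) : Prop := ~ is_iso (sub_mor m).

Definition maximal_proper (A : P) (m : sub A) : Prop :=
  proper m /\ forall n : sub A, proper n -> sub_le m n -> sub_iso m n.

Definition idem (A : P) (m : sub A) : hom A A := sub_mor m ∘ star (sub_in m).

Definition sub_rel (A : P) (m n : sub A) : Prop :=
  inM S (star (sub_in m) ∘ sub_mor n).

End Classes.

Record conditions (P : category) (S : star_data P) : Prop := Conditions {
  factor_ex : forall (A B : P) (f : hom A B),
    exists (C D : P) (m : hom C A) (r : hom C D) (n : hom D B) (hm : inM S m),
      inM S n /\ inR S r /\ f = n ∘ r ∘ star hm;
  factor_uniq : forall (A B C D C' D' : P)
    (m : hom C A) (r : hom C D) (n : hom D B)
    (m' : hom C' A) (r' : hom C' D') (n' : hom D' B)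
    (hm : inM S m) (hm' : inM S m'),
    inM S n -> inM S n' -> inR S r -> inR S r' ->
    n ∘ r ∘ star hm = n' ∘ r' ∘ star hm' ->
    exists (a : hom C C') (b : hom D D'),
      is_iso a /\ is_iso b /\ m' ∘ a = m /\ n' ∘ b = n /\ r' ∘ a = b ∘ r;
  comp_R : forall (A B C : P) (r' : hom B C) (r : hom A B),
    inR S r' -> inR S r -> inS S (r' ∘ r);
  star_R : forall (A B C : P) (r : hom A B) (m : hom C B) (hm : inM S m),
    inR S r -> inR S (star hm ∘ r) -> is_iso m;
  comp_mstar : forall (A B C D E : P) (n : hom A B) (m : hom A C)
    (n' : hom D C) (m' : hom D E) (hn : inM S n) (hn' : inM S n'),
    inM S m -> inM S m' ->
    exists (F : P) (q : hom F B) (p : hom F E) (hq : inM S q),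
      inM S p /\ (m' ∘ star hn') ∘ (m ∘ star hn) = p ∘ star hq;
  sub_finite : forall A : P,
    exists l : list (sub S A), forall m, exists n, In n l /\ sub_iso m n;
  (* [L] contains [sub_iso] (as [sub_rel] does), so by transitivity it is
     automatically a relation on isomorphism classes. *)
  sub_rel_antisym : forall A : P,
    exists L : sub S A -> sub S A -> Prop,
      (forall m n, sub_rel m n -> L m n) /\
      (forall m n k, L m n -> L n k -> L m k) /\
      (forall m n, L m n -> L n m -> sub_iso m n);
  maximal_list : forall A : P,
    exists l : list (sub S A),
      (forall m, In m l -> maximal_proper m) /\
      (forall m, maximal_proper m -> exists n, In n l /\ sub_iso m n) /\
      ForallOrdPairs (fun m n => ~ sub_iso m n) l /\
      ForallOrdPairs (fun mi mj =>
        idem mj ∘ idem mi ∘ idem mj = idem mj ∘ idem mi) l }.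

(* The pointed set p{x | Q x}: [None] is the added base point. *)
Definition psub (T : Type) (Q : T -> Prop) : Type := option (sig Q).

Definition restr (T : Type) (Q : T -> Prop) (x : T) : psub Q :=
  match excluded_middle_informative (Q x) with
  | left h => Some (exist _ x h)
  | right _ => None
  end.

Lemma restr_in (T : Type) (Q : T -> Prop) (x : T) (h : Q x) :
  restr Q x = Some (exist _ x h).
Proof.
unfold restr; destruct excluded_middle_informative as [h'|n].
- f_equal; apply sig_eq; reflexivity.
- contradiction.
Qed.

Lemma restr_out (T : Type) (Q : T -> Prop) (x : T) : ~ Q x -> restr Q x = None.
Proof.
unfold restr; destruct excluded_middle_informative; [contradiction|reflexivity].
Qed.

Section Data.
Variables (P : category) (S : star_data P) (H : conditions S).

(* s_u is in R: the factorization u = m_u s_u being unique up to isomorphism,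
   it does not matter which one is used. *)
Definition inMR (A B : P) (u : hom A B) : Prop :=
  exists (C : P) (s : hom A C) (m : hom C B),
    inS S s /\ inM S m /\ u = m ∘ s /\ inR S s.

Lemma inM_id (A : P) : inM S (idm A).
Proof. apply inM_iso; exists (idm A); rewrite comp_id_l; auto. Qed.

Lemma is_iso_inv_star (A B : P) (m : hom A B) (h : inM S m) :
  is_iso m -> star h ∘ m = idm A /\ m ∘ star h = idm B.
Proof.
intros [g [g1 g2]]; split; [apply star_mul|].
assert (E : star h = g).
{ rewrite <- (comp_id_r (star h)), <- g2, comp_assoc, star_mul.
  apply comp_id_l. }
rewrite E; exact g2.
Qed.

Lemma split_iso (A B : P) (m : hom A B) (g : hom B A) :
  inM S m -> m ∘ g = idm B -> is_iso m.
Proof.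
intros h E; exists (star h); split; [apply star_mul|].
assert (E' : star h = g).
{ rewrite <- (comp_id_r (star h)), <- E, comp_assoc, star_mul.
  apply comp_id_l. }
rewrite E'; exact E.
Qed.

Lemma cosplit_iso (A B : P) (m : hom A B) (h : inM S m) (g : hom A B) :
  g ∘ star h = idm B -> is_iso m.
Proof.
intros E; apply split_iso with (g := star h); [exact h|].
assert (E' : g = m).
{ rewrite <- (comp_id_r g), <- (star_mul h), comp_assoc, E; apply comp_id_l. }
rewrite E' in E; exact E.
Qed.

Lemma inR_id (A : P) : inR S (idm A).
Proof.
intros C D m x n hm hn E; split.
- apply split_iso with (g := x ∘ star hn); [exact hm|].
  rewrite comp_assoc; symmetry; exact E.
- apply cosplit_iso with (h := hn) (g := m ∘ x); symmetry; exact E.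
Qed.

Lemma inR_star (A B C : P) (x : hom C B) (k : hom C A) (h : inM S k) :
  inR S (x ∘ star h) -> is_iso k.
Proof.
intros HR; refine (proj2 (HR C B (idm B) x k (inM_id B) h _)).
rewrite comp_id_l; reflexivity.
Qed.

Lemma inR_inS (A B : P) (r : hom A B) : inR S r -> inS S r.
Proof.
intros HR; exists A, r, (idm A), (inM_id A); split; [exact HR|].
rewrite star_id, comp_id_r; reflexivity.
Qed.

Lemma inR_inMR (A B : P) (r : hom A B) : inR S r -> inMR r.
Proof.
intros HR; exists B, r, (idm B); split; [apply inR_inS, HR|].
split; [apply inM_id|]; split; [|exact HR].
rewrite comp_id_l; reflexivity.
Qed.

Lemma inR_iso_r (A B C : P) (r : hom A B) (a : hom C A) :
  is_iso a -> inR S r -> inR S (r ∘ a).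
Proof.
intros ia HR C' D m x n hm hn E.
assert (ha : inM S a) by (apply inM_iso, ia).
destruct (is_iso_inv_star ha ia) as [a1 a2].
assert (han : inM S (a ∘ n)) by (apply inM_comp; assumption).
destruct (HR C' D m x (a ∘ n) hm han) as [im [g [g1 g2]]].
- rewrite (star_comp ha hn han), comp_assoc, <- E.
  rewrite <- comp_assoc, a2, comp_id_r; reflexivity.
- split; [exact im|].
  apply split_iso with (g := g ∘ a); [exact hn|].
  assert (E' : n ∘ g = star ha).
  { rewrite <- (comp_id_l (n ∘ g)), <- a1, <- comp_assoc.
    rewrite (comp_assoc a n g), g2, comp_id_r; reflexivity. }
  rewrite comp_assoc, E'; exact a1.
Qed.

Lemma inMR_star (A B C D : P) (x : hom C D) (k : hom C B) (r : hom A B)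
  (hk : inM S k) : inR S r -> inMR (x ∘ star hk ∘ r) -> is_iso k.
Proof.
intros HR (E & s & m & _ & hm & Es & Rs).
destruct (factor_ex H (star hk ∘ r)) as (F & G & j & q & n & hj & hn & Rq & Ef).
assert (Es' : s = (star hm ∘ x ∘ n ∘ q) ∘ star hj).
{ rewrite <- (comp_id_l s), <- (star_mul hm), <- comp_assoc, <- Es.
  rewrite <- (comp_assoc x), Ef, !comp_assoc; reflexivity. }
assert (ij : is_iso j).
{ rewrite Es' in Rs; exact (inR_star Rs). }
assert (hkn : inM S (k ∘ n)) by (apply inM_comp; assumption).
assert (ikn : is_iso (k ∘ n)).
{ apply (star_R H) with (r := r) (hm := hkn); [exact HR|].
  rewrite (star_comp hk hn hkn), <- comp_assoc, Ef, !comp_assoc.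
  rewrite star_mul, comp_id_l.
  apply inR_iso_r; [|exact Rq].
  destruct (is_iso_inv_star hj ij) as [j1 j2]; exists j; split; assumption. }
destruct ikn as [g [g1 g2]].
apply split_iso with (g := n ∘ g); [exact hk|].
rewrite comp_assoc; exact g2.
Qed.

Lemma inMR_star1 (B C D : P) (x : hom C D) (k : hom C B) (hk : inM S k) :
  inMR (x ∘ star hk) -> is_iso k.
Proof.
intros HM; apply inMR_star with (x := x) (hk := hk) (1 := @inR_id B).
rewrite comp_id_r; exact HM.
Qed.

Lemma inMR_or (A B : P) (u : hom A B) :
  inMR u \/ exists (C : P) (k : hom C A) (hk : inM S k) (y : hom C B),
    ~ is_iso k /\ u = y ∘ star hk.
Proof.
destruct (factor_ex H u) as (C & D & k & q & n & hk & hn & Rq & E).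
destruct (classic (is_iso k)) as [ik|nk].
- left.
  assert (Rs : inR S (q ∘ star hk)).
  { apply inR_iso_r; [|exact Rq].
    destruct (is_iso_inv_star hk ik) as [k1 k2]; exists k; split; assumption. }
  exists D, (q ∘ star hk), n; split; [apply inR_inS, Rs|].
  split; [exact hn|]; split; [|exact Rs].
  rewrite comp_assoc; exact E.
- right; exists C, k, hk, (n ∘ q); split; assumption.
Qed.

Lemma inMR_mid (A B C D : P) (x : hom C D) (u : hom B C) (r : hom A B) :
  inR S r -> inMR (x ∘ u ∘ r) -> inMR u.
Proof.
intros HR HM; destruct (inMR_or u) as [Hu|(E & k & hk & y & nk & Eu)]; [exact Hu|].
exfalso; apply nk.
apply inMR_star with (x := x ∘ y) (hk := hk) (r := r); [exact HR|].
rewrite Eu, comp_assoc in HM; exact HM.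
Qed.

Lemma inMR_inR_comp (A B C D : P) (x : hom C D) (r' : hom B C) (r : hom A B) :
  inR S r' -> inR S r -> inMR (x ∘ (r' ∘ r)) -> inR S (r' ∘ r).
Proof.
intros HR' HR HM.
destruct (comp_R H HR' HR) as (E & t & k & hk & Rt & Et).
rewrite Et, comp_assoc in HM.
assert (ik : is_iso k) by (exact (inMR_star1 HM)).
rewrite Et; apply inR_iso_r; [|exact Rt].
destruct (is_iso_inv_star hk ik) as [k1 k2]; exists k; split; assumption.
Qed.

Definition D_hom (A B : P) : Type := psub (@inR P S A B).

Definition D_id (A : P) : D_hom A A := Some (exist _ (idm A) (@inR_id A)).

Definition D_comp (A B C : P) (g : D_hom B C) (f : D_hom A B) : D_hom A C :=
  match g, f with
  | Some g, Some f => restr _ (proj1_sig g ∘ proj1_sig f)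
  | _, _ => None
  end.

Lemma D_comp_id_l (A B : P) (f : D_hom A B) : D_comp (D_id B) f = f.
Proof.
destruct f as [[f Rf]|]; simpl; [|reflexivity].
rewrite comp_id_l; apply restr_in.
Qed.

Lemma D_comp_id_r (A B : P) (f : D_hom A B) : D_comp f (D_id A) = f.
Proof.
destruct f as [[f Rf]|]; simpl; [|reflexivity].
rewrite comp_id_r; apply restr_in.
Qed.

Lemma D_comp_assoc (A B C E : P)
  (h : D_hom C E) (g : D_hom B C) (f : D_hom A B) :
  D_comp h (D_comp g f) = D_comp (D_comp h g) f.
Proof.
destruct h as [[h Rh]|]; [|reflexivity].
destruct g as [[g Rg]|]; [|reflexivity].
destruct f as [[f Rf]|]; simpl; [|destruct restr; reflexivity].
destruct (classic (inR S (h ∘ g ∘ f))) as [Rt|nt].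
- assert (Rgf : inR S (g ∘ f)).
  { apply inMR_inR_comp with (x := h); [exact Rg|exact Rf|].
    rewrite comp_assoc; apply inR_inMR, Rt. }
  assert (Rhg : inR S (h ∘ g)).
  { apply inMR_inR_comp with (x := idm E); [exact Rh|exact Rg|].
    rewrite comp_id_l; apply inMR_mid with (x := idm E) (r := f); [exact Rf|].
    rewrite comp_id_l; apply inR_inMR, Rt. }
  rewrite (restr_in Rgf), (restr_in Rhg); simpl; rewrite comp_assoc; reflexivity.
- transitivity (@None (sig (@inR P S A E))).
  + destruct (classic (inR S (g ∘ f))) as [R|n].
    * rewrite (restr_in R); apply restr_out; simpl; rewrite comp_assoc; exact nt.
    * rewrite (restr_out n); reflexivity.
  + destruct (classic (inR S (h ∘ g))) as [R|n].
    * rewrite (restr_in R); symmetry; apply restr_out; exact nt.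
    * rewrite (restr_out n); reflexivity.
Qed.

Definition D_cat : category :=
  @Category P D_hom D_id D_comp D_comp_id_l D_comp_id_r D_comp_assoc.

Definition Dcat : zcategory.
Proof.
refine (@ZCategory D_cat (fun A B => None) _ _).
- intros A B C f; reflexivity.
- intros A B C [f|]; reflexivity.
Defined.

End Data.

(* A functor D^op x P -> 1/Set preserving the zero morphisms of D, unpacked:
   a category of all pointed sets would force a universe above the homs of P. *)
Record kernel (D : zcategory) (P : category) := Kernel {
  kset :> D -> P -> Type;
  kpt : forall A B, kset A B;
  kact : forall (A A' : D) (B B' : P),
    hom A' A -> hom B B' -> kset A B -> kset A' B';
  kact_pt : forall (A A' : D) (B B' : P) (r : hom A' A) (f : hom B B'),
    kact r f (kpt A B) = kpt A' B';
  kact_id : forall (A : D) (B : P) (u : kset A B), kact (idm A) (idm B) u = u;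
  kact_comp : forall (A A' A'' : D) (B B' B'' : P) (r : hom A' A)
    (r' : hom A'' A') (f : hom B B') (f' : hom B' B'') (u : kset A B),
    kact (r ∘ r') (f' ∘ f) u = kact r' f' (kact r f u);
  kact_zero : forall (A A' : D) (B B' : P) (f : hom B B') (u : kset A B),
    kact (zero A' A) f u = kpt A' B' }.
Arguments kpt {D P} k A B.
Arguments kact {D P} k {A A' B B'} r f u.

Section KernelM.
Variables (P : category) (S : star_data P) (H : conditions S).

Definition M_set (A B : P) : Type := psub (@inMR P S A B).

Definition M_act (A A' B B' : P) (r : D_hom S A' A) (f : hom B B')
  (u : M_set A B) : M_set A' B' :=
  match r, u with
  | Some r, Some u => restr _ (f ∘ proj1_sig u ∘ proj1_sig r)
  | _, _ => None
  end.

Lemma M_act_id (A B : P) (u : M_set A B) : M_act (D_id S A) (idm B) u = u.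
Proof.
destruct u as [[u Hu]|]; simpl; [|reflexivity].
rewrite comp_id_l, comp_id_r; apply restr_in.
Qed.

Lemma M_act_comp (A A' A'' B B' B'' : P) (r : D_hom S A' A)
  (r' : D_hom S A'' A') (f : hom B B') (f' : hom B' B'') (u : M_set A B) :
  M_act (D_comp r r') (f' ∘ f) u = M_act r' f' (M_act r f u).
Proof.
destruct r as [[r Rr]|]; simpl; [|destruct r'; reflexivity].
destruct r' as [[r' Rr']|]; simpl; [|reflexivity].
destruct u as [[u Hu]|]; simpl; [|destruct restr; reflexivity].
destruct (classic (inMR S (f' ∘ (f ∘ u ∘ r) ∘ r'))) as [Ht|nt].
- assert (Rrr : inR S (r ∘ r')).
  { apply (inMR_inR_comp H) with (x := f' ∘ f ∘ u); [exact Rr|exact Rr'|].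
    rewrite !comp_assoc in *; exact Ht. }
  assert (Hfur : inMR S (f ∘ u ∘ r)).
  { apply (inMR_mid H) with (x := f') (r := r'); assumption. }
  rewrite (restr_in Rrr), (restr_in Hfur); simpl; rewrite !comp_assoc; reflexivity.
- transitivity (@None (sig (@inMR P S A'' B''))).
  + destruct (classic (inR S (r ∘ r'))) as [R|n].
    * rewrite (restr_in R); apply restr_out; simpl; rewrite !comp_assoc in *.
      exact nt.
    * rewrite (restr_out n); reflexivity.
  + destruct (classic (inMR S (f ∘ u ∘ r))) as [R|n].
    * rewrite (restr_in R); symmetry; apply restr_out; exact nt.
    * rewrite (restr_out n); reflexivity.
Qed.

Definition kernelM : kernel (Dcat H) P.
Proof.
refine (@Kernel (Dcat H) P M_set (fun A B => None) M_act _ M_act_id M_act_comp _).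
- intros A A' B B' [r|] f; reflexivity.
- intros; reflexivity.
Defined.

End KernelM.

Section Induced.
Variables (D : zcategory) (P : category) (M : kernel D P) (X : zcategory).

(* Mh F B is the coend of M A B /\ F A over A in D: the maps
   in F A u : F A -> Mh F B, for u in M A B, form the universal cowedge. *)
Definition is_hat (Mh : functor (zfunctor_cat D X) (functor_cat P X)) : Prop :=
  exists i : forall (F : zfunctor D X) (B : P) (A : D),
      M A B -> hom (F A) (fob (Mh F) B),
    (forall (F : zfunctor D X) (B : P) (A : D),
       i F B A (kpt M A B) = zero (F A) (fob (Mh F) B)) /\
    (forall (F : zfunctor D X) (B : P) (A A' : D) (r : hom A' A) (u : M A B),
       i F B A' (kact M r (idm B) u) = i F B A u ∘ fmap F r) /\
    (forall (F : zfunctor D X) (B B' : P) (A : D) (f : hom B B') (u : M A B),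
       i F B' A (kact M (idm A) f u) = fmap (Mh F) f ∘ i F B A u) /\
    (forall (F G : zfunctor_cat D X) (t : hom F G) (B : P) (A : D) (u : M A B),
       nt_app (fmap Mh t) B ∘ i F B A u = i G B A u ∘ nt_app t A) /\
    (forall (F : zfunctor D X) (B : P) (Y : X)
        (j : forall A : D, M A B -> hom (F A) Y),
       (forall A : D, j A (kpt M A B) = zero (F A) Y) ->
       (forall (A A' : D) (r : hom A' A) (u : M A B),
          j A' (kact M r (idm B) u) = j A u ∘ fmap F r) ->
       exists! h : hom (fob (Mh F) B) Y,
         forall (A : D) (u : M A B), h ∘ i F B A u = j A u).

(* Mt T A is the end of [M A B, T B] over B in P: the maps
   p T A u : Mt T A -> T B, for u in M A B, form the universal wedge. *)
Definition is_tilde (Mt : functor (functor_cat P X) (zfunctor_cat D X)) : Prop :=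
  exists p : forall (T : functor P X) (A : D) (B : P),
      M A B -> hom (fob (Mt T) A) (T B),
    (forall (T : functor P X) (A : D) (B : P),
       p T A B (kpt M A B) = zero (fob (Mt T) A) (T B)) /\
    (forall (T : functor P X) (A : D) (B B' : P) (f : hom B B') (u : M A B),
       p T A B' (kact M (idm A) f u) = fmap T f ∘ p T A B u) /\
    (forall (T : functor P X) (A A' : D) (B : P) (r : hom A' A) (u : M A B),
       p T A' B (kact M r (idm B) u) = p T A B u ∘ fmap (Mt T) r) /\
    (forall (T U : functor_cat P X) (t : hom T U) (A : D) (B : P) (u : M A B),
       p U A B u ∘ nt_app (fmap Mt t) A = nt_app t B ∘ p T A B u) /\
    (forall (T : functor P X) (A : D) (Y : X)
        (q : forall B : P, M A B -> hom Y (T B)),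
       (forall B : P, q B (kpt M A B) = zero Y (T B)) ->
       (forall (B B' : P) (f : hom B B') (u : M A B),
          q B' (kact M (idm A) f u) = fmap T f ∘ q B u) ->
       exists! h : hom Y (fob (Mt T) A),
         forall (B : P) (u : M A B), p T A B u ∘ h = q B u).

End Induced.

(* Main.v *)
(* The transformations between functors P -> X restrict to the joint kernels of
   the maps T m_i^*, for m_1, ..., m_n the maximal proper subobjects of A, so
   everything is a statement about the idempotents c_i induced by m_i m_i^* on T A.
   As c_j c_i c_j = c_j c_i for i < j, each c_i acts on the joint kernel of the
   later c_j, which allows an induction on the length of the list.
   - Conservativity: the fixed points of c_i are a copy of T (dom m_i), on which
     the transformation is invertible by induction on the size of Sub A; adding
     the c_i one at a time, the split short five lemma gives the claim at A.
   - Reflexive coequalizers q of (f, g): by the Mal'tsev property, regular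
     epimorphisms commuting with the c_i restrict to regular epimorphisms on
     joint kernels. This applies to q and to the comparison from the domain of
     f and g to the kernel pair of q, and q is then the coequalizer of its
     kernel pair also on joint kernels.
   The adjunction is formal: maps out of the coend and maps into the end are
   both families F A -> T B indexed by M (A, B) and natural in A and B. *)

From Stdlib Require Import List Classical ClassicalEpsilon.
From Stdlib Require Import ProofIrrelevance.
Require Import Defs.
Set Implicit Arguments.
Unset Strict Implicit.
Unset Printing Implicit Defensive.
Open Scope cat_scope.
Import ListNotations.

(** * Rewriting up to associativity, and monomorphisms *)

Lemma comp_eq (C : category) (A B E : C) (g : hom B E) (f : hom A B)
  (k : hom A E) : g ∘ f = k ->
  forall (F : C) (h : hom E F), h ∘ g ∘ f = h ∘ k.
Proof. intros <- F h; symmetry; apply comp_assoc. Qed.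

Lemma comp_eq3 (C : category) (A A' B E : C) (g : hom B E) (f : hom A' B)
  (e : hom A A') (k : hom A E) : g ∘ f ∘ e = k ->
  forall (F : C) (h : hom E F), h ∘ g ∘ f ∘ e = h ∘ k.
Proof. intros <- F h; rewrite !comp_assoc; reflexivity. Qed.

(** With composites bracketed to the left, the left side [g ∘ f] of an equation shows up inside a
    longer composite only as [h ∘ g ∘ f]. So the equation itself is tried first, then its versions
    with a prefix [h] for two and three factors. *)
Ltac crw E :=
  rewrite ?comp_assoc;
  first [rewrite E | rewrite (comp_eq E) | rewrite (comp_eq3 E)];
  rewrite ?comp_assoc, ?comp_id_l, ?comp_id_r.

Definition mono (C : category) (A B : C) (m : hom A B) : Prop :=
  forall (Z : C) (u v : hom Z A), m ∘ u = m ∘ v -> u = v.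

Lemma split_mono (C : category) (A B : C) (m : hom A B) (r : hom B A) :
  r ∘ m = idm A -> mono m.
Proof.
intros E Z u v H.
rewrite <- (comp_id_l u), <- (comp_id_l v), <- E, <- !comp_assoc, H.
reflexivity.
Qed.

Lemma mono_split_iso (C : category) (A B : C) (m : hom A B) (g : hom B A) :
  mono m -> m ∘ g = idm B -> is_iso m.
Proof.
intros Hm E; exists g; split; [|exact E].
apply Hm; rewrite comp_assoc, E, comp_id_l, comp_id_r; reflexivity.
Qed.

(** * Finite limits *)

Section System.
Variables (C : category) (I K : Type) (X : I -> C) (Y : K -> C).
Variables (s : bool -> K -> I) (f : forall b k, hom (X (s b k)) (Y k)).

(** The shape of a finite system of equations: [I] indexes the unknowns, [K] the equations, and
    equation [k] equates the images of the unknowns [s true k] and [s false k] under [f true k] and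
    [f false k]. Arrows into an equation are indexed by its side [b], so an unknown on both sides
    has two parallel arrows. *)
Definition system_hom (x y : I + K) : Type :=
  match x, y with
  | inl i, inl j => i = j
  | inl i, inr k => { b : bool | i = s b k }
  | inr _, inl _ => False
  | inr k, inr k' => k = k'
  end.

Definition system_id (x : I + K) : system_hom x x :=
  match x with inl _ => eq_refl | inr _ => eq_refl end.

Definition system_comp (x y z : I + K) :
  system_hom y z -> system_hom x y -> system_hom x z.
Proof.
destruct x as [i|k], y as [j|l], z as [i'|k']; simpl; intros g h;
  try contradiction; subst; first [exact g | exact h | reflexivity].
Defined.

Definition system_cat : category.
Proof.
refine (@Category (I + K) system_hom system_id system_comp _ _ _).
- intros [i|k] [j|l] h; simpl in *; try contradiction;
    try destruct h; subst; reflexivity.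
- intros [i|k] [j|l] h; simpl in *; try contradiction; subst; reflexivity.
- intros [i|k] [j|l] [i'|k'] [i''|k''] h g e; simpl in *; try contradiction;
    try destruct h; try destruct g; try destruct e; subst; reflexivity.
Defined.

Definition system_ob (x : I + K) : C :=
  match x with inl i => X i | inr k => Y k end.

Definition system_map (x y : I + K) :
  system_hom x y -> hom (system_ob x) (system_ob y).
Proof.
destruct x as [i|k], y as [j|l]; simpl; intros h.
- subst; apply idm.
- destruct h as [b ->]; apply f.
- contradiction.
- subst; apply idm.
Defined.

Definition system_functor : functor system_cat C.
Proof.
refine (@Functor system_cat C system_ob system_map _ _).
- intros [i|k]; reflexivity.
- intros [i|k] [j|l] [i'|k'] g h; simpl in *; try contradiction;
    try destruct g; try destruct h; subst; simpl;
    rewrite ?comp_id_l, ?comp_id_r; reflexivity.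
Defined.

Lemma finite_eq (T : Type) (x y : T) : finite_type (x = y).
Proof.
destruct (classic (x = y)) as [E|n].
- exists [E]; intros E'; left; apply proof_irrelevance.
- exists []; intros E; contradiction.
Qed.

Lemma finite_system_cat : finite_type I -> finite_type K ->
  finite_category system_cat.
Proof.
intros [li Hi] [lk Hk]; split.
- exists (map inl li ++ map inr lk); intros [i|k]; apply in_or_app;
    [left|right]; apply in_map; auto.
- intros [i|k] [j|l]; simpl; try apply finite_eq.
  + assert (Hb : forall b, exists L : list {b | i = s b l},
      forall x, proj1_sig x = b -> In x L).
    { intros b; destruct (classic (i = s b l)) as [E|n].
      - exists [exist _ b E]; intros [b' E'] Eb; simpl in Eb; subst b'.
        left; f_equal; apply proof_irrelevance.
      - exists []; intros [b' E'] Eb; simpl in Eb; subst b'; contradiction. }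
    destruct (Hb true) as [L1 H1], (Hb false) as [L2 H2].
    exists (L1 ++ L2); intros x; apply in_or_app.
    destruct (proj1_sig x) eqn:E; [left; auto|right; auto].
  + exists []; intros [].
Qed.

(** The component of a cone at an equation is the common value of its two sides, so cones are
    solutions of the system and a limit is the universal solution. *)
Lemma system_limit : finitely_complete C -> finite_type I -> finite_type K ->
  exists (L : C) (p : forall i, hom L (X i)),
    (forall k, f true k ∘ p (s true k) = f false k ∘ p (s false k)) /\
    forall (Z : C) (q : forall i, hom Z (X i)),
      (forall k, f true k ∘ q (s true k) = f false k ∘ q (s false k)) ->
      exists h : hom Z L, (forall i, p i ∘ h = q i) /\
        (forall h', (forall i, p i ∘ h' = q i) -> h = h').
Proof.
intros HC FI FK.
destruct (HC system_cat system_functor (finite_system_cat FI FK))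
  as (L & p & cp & up).
assert (E : forall b k, f b k ∘ p (inl (s b k)) = p (inr k)).
{ intros b k.
  exact (cp (inl (s b k)) (inr k) (exist (fun b' => s b k = s b' k) b eq_refl)). }
exists L, (fun i => p (inl i)); split.
- intros k; rewrite !E; reflexivity.
- intros Z q Hq.
  destruct (up Z (fun x => match x return hom Z (system_ob x) with
                           | inl i => q i
                           | inr k => f true k ∘ q (s true k) end))
    as (h & Hh & uh).
  + intros [i|k] [j|l] a; simpl in a; try contradiction.
    * subst; simpl; apply comp_id_l.
    * destruct a as [b Ea]; subst; destruct b; simpl; [reflexivity|].
      symmetry; apply Hq.
    * subst; simpl; apply comp_id_l.
  + exists h; split; [intros i; exact (Hh (inl i))|].
    intros h' Hh'; apply uh; intros [i|k]; [apply Hh'|].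
    rewrite <- (E true k), <- comp_assoc; f_equal; apply Hh'.
Qed.

End System.

Lemma finite_unit : finite_type unit.
Proof. exists [tt]; intros []; left; reflexivity. Qed.

Lemma finite_bool : finite_type bool.
Proof. exists [true; false]; intros []; simpl; auto. Qed.

Lemma finite_Empty : finite_type Empty_set.
Proof. exists []; intros []. Qed.

Section Limits.
Variables (C : category) (HC : finitely_complete C).

(** One unknown and one equation; the pullbacks and products below have two unknowns, with one
    equation or none. *)
Lemma equalizer_ex (A B : C) (f g : hom A B) :
  exists (L : C) (e : hom L A), mono e /\ f ∘ e = g ∘ e /\
    forall (Z : C) (a : hom Z A), f ∘ a = g ∘ a -> exists h, e ∘ h = a.
Proof.
destruct (@system_limit C unit unit (fun _ => A) (fun _ => B) (fun _ _ => tt)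
  (fun b _ => if b then f else g) HC finite_unit finite_unit)
  as (L & p & E & u).
exists L, (p tt); split; [|split].
- intros Z a b Eab.
  destruct (u Z (fun _ => p tt ∘ a)) as (h & _ & uh).
  + intros k; rewrite !comp_assoc; f_equal; apply (E tt).
  + rewrite <- (uh a), <- (uh b); [reflexivity| |]; intros []; auto.
- apply (E tt).
- intros Z a Ea; destruct (u Z (fun _ => a)) as (h & Hh & _).
  + intros k; exact Ea.
  + exists h; apply Hh.
Qed.

Lemma pullback_ex (A B E : C) (f : hom A E) (g : hom B E) :
  exists (L : C) (p : hom L A) (q : hom L B), is_pullback f g p q.
Proof.
destruct (@system_limit C bool unit (fun b => if b then A else B) (fun _ => E)
  (fun b _ => b)
  (fun b _ => if b return hom (if b then A else B) E then f else g)
  HC finite_bool finite_unit) as (L & p & Ep & u).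
exists L, (p true), (p false); split; [exact (Ep tt)|].
intros Z a b Eab.
destruct (u Z (fun c => if c return hom Z (if c then A else B) then a else b))
  as (h & Hh & uh); [intros k; exact Eab|].
exists h; split; [split; [exact (Hh true)|exact (Hh false)]|].
intros h' [E1 E2]; apply uh; intros []; assumption.
Qed.

Lemma product_ex (A B : C) :
  exists (L : C) (p : hom L A) (q : hom L B),
    (forall (Z : C) (a : hom Z A) (b : hom Z B), exists h, p ∘ h = a /\ q ∘ h = b) /\
    (forall (Z : C) (u v : hom Z L), p ∘ u = p ∘ v -> q ∘ u = q ∘ v -> u = v).
Proof.
destruct (@system_limit C bool Empty_set (fun b => if b then A else B)
  (fun k => match k with end)
  (fun b _ => b) (fun b k => match k with end)
  HC finite_bool finite_Empty) as (L & p & _ & u).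
exists L, (p true), (p false); split.
- intros Z a b.
  destruct (u Z (fun c => if c return hom Z (if c then A else B) then a else b))
    as (h & Hh & uh); [intros []|].
  exists h; split; [exact (Hh true)|exact (Hh false)].
- intros Z a b E1 E2.
  destruct (u Z (fun c => p c ∘ a)) as (h & _ & uh); [intros []|].
  rewrite <- (uh a), <- (uh b); [reflexivity| |]; intros []; auto.
Qed.

End Limits.

Lemma pullback_ext (C : category) (A B E L : C) (f : hom A E) (g : hom B E)
  (p : hom L A) (q : hom L B) (Z : C) (u v : hom Z L) :
  is_pullback f g p q -> p ∘ u = p ∘ v -> q ∘ u = q ∘ v -> u = v.
Proof.
intros [E0 U] E1 E2.
destruct (U Z (p ∘ v) (q ∘ v)) as (h & _ & uh); [crw E0; reflexivity|].
rewrite <- (uh u), <- (uh v); auto.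
Qed.

Lemma pullback_lift (C : category) (A B E L : C) (f : hom A E) (g : hom B E)
  (p : hom L A) (q : hom L B) (Z : C) (a : hom Z A) (b : hom Z B) :
  is_pullback f g p q -> f ∘ a = g ∘ b -> exists h, p ∘ h = a /\ q ∘ h = b.
Proof. intros [_ U] Eab; destruct (U Z a b Eab) as (h & Hh & _); eauto. Qed.

(** * Regular epimorphisms *)

Lemma regular_epi_epi (C : category) (A B Y : C) (q : hom A B) (u v : hom B Y) :
  regular_epi q -> u ∘ q = v ∘ q -> u = v.
Proof.
intros (E & a & b & Eq & U) H.
destruct (U Y (v ∘ q)) as (k & _ & uk); [crw Eq; reflexivity|].
rewrite <- (uk u H), <- (uk v eq_refl); reflexivity.
Qed.

(** The map [q] coequalizes some pair, and [u] equates that pair because [m ∘ u] does and [m] is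
    mono; the factorization of [u] through [q] is the diagonal. *)
Lemma regular_epi_strong (C : category) (A B Y Z : C) (q : hom A B)
  (m : hom Y Z) (u : hom A Y) (v : hom B Z) :
  regular_epi q -> mono m -> v ∘ q = m ∘ u -> exists d, m ∘ d = v.
Proof.
intros Rq Hm H; pose proof Rq as (E & a & b & Eq & U).
destruct (U Y u) as (d & Ed & _).
- apply Hm; rewrite !comp_assoc, <- H, <- !comp_assoc, Eq; reflexivity.
- exists d; apply (regular_epi_epi Rq); rewrite H, <- Ed, comp_assoc; reflexivity.
Qed.

Lemma regular_epi_id (C : category) (A : C) : regular_epi (idm A).
Proof.
exists A, (idm A), (idm A); split; [reflexivity|].
intros Y h _; exists h; split; [apply comp_id_r|].
intros h' <-; apply comp_id_r.
Qed.

Lemma regular_epi_iso (C : category) (A B E : C) (q : hom A B) (m : hom B E) :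
  regular_epi q -> is_iso m -> regular_epi (m ∘ q).
Proof.
intros (F & a & b & Eq & U) (g & g1 & g2); exists F, a, b; split.
- rewrite <- !comp_assoc, Eq; reflexivity.
- intros Y h Hh; destruct (U Y h Hh) as (k & Ek & uk).
  exists (k ∘ g); split.
  + crw g1; exact Ek.
  + intros k' Ek'; rewrite (uk (k' ∘ m)).
    * crw g2; reflexivity.
    * rewrite <- Ek'; symmetry; apply comp_assoc.
Qed.

Section Regular.
Variables (C : category) (HR : regular C).

(** In terms of generalized elements, a regular epimorphism is surjective up to a cover [e] of the
    stage [Z], obtained by pulling [f] back along [y]. Covers are cancelled again by
    [regular_epi_epi]. *)
Lemma regular_epi_lift (A B Z : C) (f : hom A B) (y : hom Z B) :
  regular_epi f ->
  exists (Z' : C) (e : hom Z' Z) (x : hom Z' A), regular_epi e /\ f ∘ x = y ∘ e.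
Proof.
intros Rf; destruct HR as (HC & _ & HP).
destruct (pullback_ex HC f y) as (L & p & q & Hpb).
exists L, q, p; split; [exact (HP _ _ _ _ _ _ _ _ Hpb Rf)|apply Hpb].
Qed.

(** The image is the coequalizer [c] of the kernel pair. Two elements with the same value under [m]
    lift along [c] on a common cover, and the lifts form an element of the kernel pair, so [c]
    identifies them; hence [m] is mono. *)
Lemma image_ex (A B : C) (f : hom A B) :
  exists (I : C) (e : hom A I) (m : hom I B),
    regular_epi e /\ mono m /\ f = m ∘ e.
Proof.
destruct HR as (HC & HK & _).
destruct (pullback_ex HC f f) as (R & p & q & Hpq).
destruct (HK _ _ _ _ _ _ Hpq) as (I & c & Hc).
assert (Rc : regular_epi c) by (exists R, p, q; exact Hc).
destruct Hc as [Ec Uc].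
destruct (Uc B f) as (m & Em & _); [apply Hpq|].
exists I, c, m; split; [exact Rc|split; [|symmetry; exact Em]].
intros Z u v Euv.
destruct (regular_epi_lift u Rc) as (Z1 & e1 & x & R1 & E1).
destruct (regular_epi_lift (v ∘ e1) Rc) as (Z2 & e2 & y & R2 & E2).
destruct (pullback_lift (a := x ∘ e2) (b := y) Hpq) as (h & h1 & h2).
- rewrite <- Em; crw E1; crw Euv; crw E2; reflexivity.
- apply (regular_epi_epi R1), (regular_epi_epi R2).
  rewrite <- E1, <- E2, <- comp_assoc, <- h1, <- h2, !comp_assoc, Ec; reflexivity.
Qed.

(** Orthogonality against [z'] lifts [z] through the mono part of [f], and then orthogonality
    against [z] lifts the identity, so the mono part is invertible. With [z] an identity: a map is a
    regular epimorphism if the generic element of its codomain lifts locally. *)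
Lemma regular_epi_of_factor (A B E F : C) (z : hom E F) (z' : hom B E)
  (f : hom A F) (x : hom B A) :
  regular_epi z -> regular_epi z' -> z ∘ z' = f ∘ x -> regular_epi f.
Proof.
intros Rz Rz' H; destruct (image_ex f) as (I & e & m & Re & Hm & ->).
destruct (regular_epi_strong (u := e ∘ x) (v := z) Rz' Hm) as (d & Ed).
{ rewrite H, !comp_assoc; reflexivity. }
destruct (regular_epi_strong (u := d) (v := idm F) Rz Hm) as (d' & Ed').
{ rewrite comp_id_l; auto. }
apply regular_epi_iso; [exact Re|]; exact (mono_split_iso Hm Ed').
Qed.

Lemma regular_epi_comp (A B E : C) (g : hom B E) (f : hom A B) :
  regular_epi g -> regular_epi f -> regular_epi (g ∘ f).
Proof.
intros Rg Rf; apply regular_epi_of_factor with (z := g) (z' := f) (x := idm A);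
  [exact Rg|exact Rf|rewrite comp_id_r; reflexivity].
Qed.

End Regular.

Lemma kernel_mono (X : zcategory) (K A B : X) (p : hom A B) (k : hom K A) :
  is_kernel p k -> mono k.
Proof.
intros [E U] Z u v H.
destruct (U Z (k ∘ v)) as (h & _ & uh); [crw E; apply zero_l|].
rewrite <- (uh u H), <- (uh v eq_refl); reflexivity.
Qed.

Lemma kernel_lift (X : zcategory) (K A B : X) (p : hom A B) (k : hom K A)
  (Z : X) (a : hom Z A) :
  is_kernel p k -> p ∘ a = zero Z B -> exists h, k ∘ h = a.
Proof. intros [_ U] H; destruct (U Z a H) as (h & Hh & _); eauto. Qed.

(** * The Mal'tsev property *)

Section Protomodular.
Variables (X : zcategory) (HX : protomodular X).

(** Here [f] is a morphism of points from [(p, s)] to [(q, f ∘ s)]. The last two hypotheses make it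
    bijective on elements of the kernels, so the conservative kernel functor sends it to an
    isomorphism. *)
Lemma split_short_five (A E B : X) (p : hom E A) (s : hom A E) (q : hom B A)
  (f : hom E B) :
  p ∘ s = idm A -> q ∘ f = p ->
  (forall (Z : X) (b : hom Z B), q ∘ b = zero Z A -> exists a, f ∘ a = b) ->
  (forall (Z : X) (a a' : hom Z E), p ∘ a = zero Z A -> p ∘ a' = zero Z A ->
     f ∘ a = f ∘ a' -> a = a') ->
  is_iso f.
Proof.
intros Eps Eqf Hs Hi.
destruct HX as [_ HK]; destruct (HK A) as (K & (k & Hk & nk) & cK).
pose (x := @Point X A E p s Eps).
assert (Eqs : q ∘ (f ∘ s) = idm A) by (crw Eqf; exact Eps).
pose (y := @Point X A B q (f ∘ s) Eqs).
pose (g := exist _ f (conj Eqf eq_refl) : @hom (Pt A) x y).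
assert (Hg : is_iso g).
{ apply cK.
  (* A preimage of the generic element [k y] of the kernel of [q] gives the inverse on kernels. *)
  destruct (Hs _ (k y)) as [a Ea]; [apply (Hk y)|].
  destruct (kernel_lift (a := a) (Hk x)) as [h Eh].
  { simpl; rewrite <- Eqf, <- comp_assoc, Ea; apply (Hk y). }
  assert (E1 : fmap K g ∘ h = idm (K y)).
  { apply (kernel_mono (Hk y)); crw (nk x y g); simpl; crw Eh; exact Ea. }
  exists h; split; [|exact E1].
  apply (kernel_mono (Hk x)), Hi.
  - change (pt_p x ∘ (k x ∘ (h ∘ fmap K g)) = zero (K x) A).
    rewrite comp_assoc, (proj1 (Hk x)); apply zero_l.
  - change (pt_p x ∘ (k x ∘ idm (K x)) = zero (K x) A).
    rewrite comp_assoc, (proj1 (Hk x)); apply zero_l.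
  - pose (kx := k x : hom (K x) E); pose (ky := k y : hom (K y) B).
    assert (N : f ∘ kx = ky ∘ fmap K g) by (symmetry; apply (nk x y g)).
    change (f ∘ (kx ∘ (h ∘ fmap K g)) = f ∘ (kx ∘ idm (K x))).
    crw N; crw E1; reflexivity. }
destruct Hg as ([h [h1 h2]] & E1 & E2); exists h; split.
- exact (f_equal (@proj1_sig _ _) E1).
- exact (f_equal (@proj1_sig _ _) E2).
Qed.

(* Protomodular categories are Mal'tsev: the pairs (a, b, c) of elements
   [a, b, c] of [W] with first coordinates of [a, b] equal and second coordinates
   of [b, c] equal form a point over the pairs (a, b), split by c = b; the
   triples whose fourth corner lies in [W] contain its section and its kernel. *)
Lemma difunctional (A B AB W Z : X) (p1 : hom AB A) (p2 : hom AB B)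
  (m : hom W AB) (a b c : hom Z W) (d : hom Z AB) :
  (forall (Y : X) (u v : hom Y AB), p1 ∘ u = p1 ∘ v -> p2 ∘ u = p2 ∘ v -> u = v) ->
  (forall (Y : X) (u : hom Y A) (v : hom Y B), exists h, p1 ∘ h = u /\ p2 ∘ h = v) ->
  mono m ->
  p1 ∘ m ∘ a = p1 ∘ m ∘ b -> p2 ∘ m ∘ b = p2 ∘ m ∘ c ->
  p1 ∘ d = p1 ∘ m ∘ c -> p2 ∘ d = p2 ∘ m ∘ a ->
  exists w : hom Z W, m ∘ w = d.
Proof.
intros ext pair Hm Eab Ebc Ed1 Ed2.
assert (HC : finitely_complete X) by apply HX.
destruct (pullback_ex HC (p1 ∘ m) (p1 ∘ m)) as (E & al & be & HE).
destruct (pullback_ex HC (p2 ∘ m ∘ be) (p2 ∘ m)) as (T & t & ga & HT).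
destruct (pair T (p1 ∘ m ∘ ga) (p2 ∘ m ∘ al ∘ t)) as (v & v1 & v2).
destruct (pullback_ex HC v m) as (T' & j & de & HT').
destruct (pullback_lift (a := idm E) (b := be) HT) as (s & s1 & s2).
{ apply comp_id_r. }
destruct (pullback_lift (a := s) (b := al) HT') as (s' & s1' & s2').
{ apply ext; [crw v1; crw s2; symmetry; apply HE|].
  crw v2; crw s1; reflexivity. }
assert (ij : is_iso j).
{ apply split_short_five with (A := E) (p := t ∘ j) (s := s') (q := t).
  - crw s1'; exact s1.
  - reflexivity.
  (* On the kernel of [t] the first two elements of the triple vanish, so its fourth corner is the
     third element [ga ∘ y], which lies in [W]. *)
  - intros Y y Ey.
    destruct (pullback_lift (a := y) (b := ga ∘ y) HT') as (h & h1 & _).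
    + apply ext; [crw v1; reflexivity|].
      crw v2; crw Ey; rewrite <- (proj1 HT).
      crw Ey; rewrite ?zero_r; reflexivity.
    + exists h; exact h1.
  - intros Y u u' _ _ Euu.
    apply (pullback_ext HT'); [exact Euu|apply Hm].
    rewrite !comp_assoc, <- (proj1 HT'), <- !comp_assoc, Euu; reflexivity. }
destruct ij as (g & _ & jg).
destruct (pullback_lift (a := a) (b := b) HE) as (e & e1 & e2); [exact Eab|].
destruct (pullback_lift (a := e) (b := c) HT) as (h & h1 & h2).
{ crw e2; exact Ebc. }
exists (de ∘ g ∘ h).
rewrite !comp_assoc, <- (proj1 HT'); crw jg.
apply ext.
- crw v1; crw h2; symmetry; exact Ed1.
- crw v2; crw h1; crw e1; symmetry; exact Ed2.
Qed.

End Protomodular.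

(** * Reflexive coequalizers and idempotents *)

Section Semiabelian.
Variables (X : zcategory) (HX : semiabelian X).

Let HC : finitely_complete X := proj1 (proj1 HX).
Let HR : regular X := proj1 (proj1 (proj2 HX)).

(** The image of [(f, g)] in [B × B] is a reflexive relation, by [difunctional] an equivalence
    relation, and by Barr exactness a kernel pair. *)
Lemma reflexive_image (A B : X) (f g : hom A B) :
  reflexive_pair f g ->
  exists (R E : X) (r1 r2 : hom R B) (e : hom A R) (h : hom B E),
    regular_epi e /\ f = r1 ∘ e /\ g = r2 ∘ e /\ is_kernel_pair h r1 r2.
Proof.
intros (s & sf & sg).
destruct (product_ex HC B B) as (BB & p1 & p2 & pair & ext).
destruct (pair A f g) as (fg & Ef & Eg).
destruct (image_ex HR fg) as (R & e & m & Re & Hm & ->).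
rewrite comp_assoc in Ef, Eg.
assert (D : forall (Y : X) (a b c : hom Y R),
  p1 ∘ m ∘ a = p1 ∘ m ∘ b -> p2 ∘ m ∘ b = p2 ∘ m ∘ c ->
  exists w, p1 ∘ m ∘ w = p1 ∘ m ∘ c /\ p2 ∘ m ∘ w = p2 ∘ m ∘ a).
{ intros Y a b c E1 E2.
  destruct (pair Y (p1 ∘ m ∘ c) (p2 ∘ m ∘ a)) as (d & d1 & d2).
  destruct (difunctional (proj1 HX) ext pair Hm E1 E2 d1 d2) as (w & Ew).
  exists w; rewrite <- !comp_assoc, Ew, !comp_assoc; split; assumption. }
assert (refl : forall (Y : X) (b : hom Y B),
  p1 ∘ m ∘ (e ∘ s ∘ b) = b /\ p2 ∘ m ∘ (e ∘ s ∘ b) = b).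
{ intros Y b; split; [crw Ef; crw sf|crw Eg; crw sg]; reflexivity. }
destruct (proj2 (proj1 (proj2 HX)) R B (p1 ∘ m) (p2 ∘ m)) as (E & h & Hh).
{ split.
  - intros Y t u E1 E2; apply Hm, ext; rewrite !comp_assoc; assumption.
  (* For related pairs [(x, y)] and [(y, z)], [D] applied to [(x, x)], [(x, y)], [(y, y)] gives
     [(y, x)], and applied to [(y, z)], [(y, y)], [(x, y)] it gives [(x, z)]. *)
  - intros Y; repeat split.
    + intros b; exists (e ∘ s ∘ b); apply refl.
    + intros a b (t & <- & <-).
      destruct (refl Y (p1 ∘ m ∘ t)) as [a1 a2].
      destruct (refl Y (p2 ∘ m ∘ t)) as [b1 b2].
      destruct (D Y (e ∘ s ∘ (p1 ∘ m ∘ t)) t (e ∘ s ∘ (p2 ∘ m ∘ t)))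
        as (w & w1 & w2); [exact a1|symmetry; exact b2|].
      exists w; rewrite w1, w2; auto.
    + intros a b c (t & <- & Et) (u & Eu & <-).
      destruct (refl Y b) as [b1 b2].
      destruct (D Y u (e ∘ s ∘ b) t) as (w & w1 & w2).
      * rewrite Eu; auto.
      * rewrite Et; auto.
      * exists w; auto. }
exists R, E, (p1 ∘ m), (p2 ∘ m), e, h; auto.
Qed.

(** Since [e] is epi, [(f, g)] and the kernel pair [(r1, r2)] have the same coequalizer. *)
Lemma reflexive_coequalizers : has_reflexive_coequalizers X.
Proof.
intros A B f g Hfg.
destruct (reflexive_image Hfg) as (R & E & r1 & r2 & e & h & Re & -> & -> & Hh).
destruct HR as (_ & HK & _); destruct (HK _ _ _ _ _ _ Hh) as (Q & q & Eq & Uq).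
exists Q, q; split.
- rewrite !comp_assoc, Eq; reflexivity.
- intros Y k Ek; apply Uq, (regular_epi_epi Re); rewrite <- !comp_assoc; exact Ek.
Qed.

(** The map [h] with kernel pair [(r1, r2)] factors through [q], so [(u, v)] is an element of [R]
    and lifts along the cover [e]. In this sense [A] covers the kernel pair of [q]. *)
Lemma reflexive_coequalizer_cover (A B Q : X) (f g : hom A B) (q : hom B Q) :
  reflexive_pair f g -> is_coequalizer f g q ->
  forall (Z : X) (u v : hom Z B), q ∘ u = q ∘ v ->
  exists (Z' : X) (e : hom Z' Z) (x : hom Z' A),
    regular_epi e /\ f ∘ x = u ∘ e /\ g ∘ x = v ∘ e.
Proof.
intros Hfg [Eq Uq] Z u v Euv.
destruct (reflexive_image Hfg) as (R & E & r1 & r2 & e & h & Re & -> & -> & Hh).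
destruct (Uq E h) as (k & Ek & _).
{ rewrite !comp_assoc, (proj1 Hh); reflexivity. }
destruct (pullback_lift (a := u) (b := v) Hh) as (t & t1 & t2).
{ rewrite <- Ek; crw Euv; reflexivity. }
destruct (regular_epi_lift HR t Re) as (Z' & e' & x & Re' & Ex).
exists Z', e', x; split; [exact Re'|split].
- crw Ex; crw t1; reflexivity.
- crw Ex; crw t2; reflexivity.
Qed.

Lemma kernel_pair_coequalizer (B Q Y : X) (q : hom B Q) (h : hom B Y) :
  regular_epi q ->
  (forall (Z : X) (u v : hom Z B), q ∘ u = q ∘ v -> h ∘ u = h ∘ v) ->
  exists! k : hom Q Y, k ∘ q = h.
Proof. intros (A & a & b & Eq & U) H; apply U, H, Eq. Qed.

Definition killed (I : Type) (A : X) (B : I -> X) (c : forall i, hom A (B i))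
  (l : list I) (Z : X) (x : hom Z A) : Prop :=
  forall i, In i l -> c i ∘ x = zero Z (B i).

Lemma killed_comp (I : Type) (A : X) (B : I -> X) (c : forall i, hom A (B i))
  (l : list I) (Z Z' : X) (x : hom Z A) (z : hom Z' Z) :
  killed c l x -> killed c l (x ∘ z).
Proof. intros H i Hi; crw (H i Hi); apply zero_l. Qed.

Lemma joint_kernel_ex (I : Type) (A : X) (B : I -> X)
  (c : forall i, hom A (B i)) (l : list I) :
  exists (K : X) (k : hom K A), mono k /\ killed c l k /\
    forall (Z : X) (x : hom Z A), killed c l x -> exists h, k ∘ h = x.
Proof.
induction l as [|i l (K & k & Hm & Hk & Uk)].
- exists A, (idm A); split; [|split].
  + intros Z u v; rewrite !comp_id_l; auto.
  + intros i [].
  + intros Z x _; exists x; apply comp_id_l.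
- destruct (equalizer_ex HC (c i ∘ k) (zero K (B i))) as (L & e & He & Ee & Ue).
  exists L, (k ∘ e); split; [|split].
  + intros Z u v; rewrite <- !comp_assoc; intros E; apply He, Hm, E.
  + intros j [<-|Hj]; [crw Ee; apply zero_l|].
    exact (killed_comp _ Hk Hj).
  + intros Z x Hx; destruct (Uk Z x) as [h Eh].
    { intros j Hj; apply Hx; right; exact Hj. }
    destruct (Ue Z h) as [h' Eh'].
    { crw Eh; rewrite (Hx i (or_introl eq_refl)), zero_l; reflexivity. }
    exists h'; crw Eh'; exact Eh.
Qed.

Section Idempotents.
Variables (I : Type) (A B : X) (c : I -> hom A A) (d : I -> hom B B).
Variable f : hom A B.
Hypothesis fc : forall i, f ∘ c i = d i ∘ f.
Hypothesis cc : forall i, c i ∘ c i = c i.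

(* With [K] the joint kernel of the later idempotents, an element y killed by
   everything is the image of some x in [K], and (c x, y), (c x, 0), (0, 0) are
   in the image of (c, f) : K -> A x B; by difunctionality so is (0, y). *)
Lemma joint_kernel_cover (l : list I) :
  regular_epi f ->
  ForallOrdPairs (fun i j => c j ∘ c i ∘ c j = c j ∘ c i) l ->
  forall (Z : X) (y : hom Z B), killed d l y ->
  exists (Z' : X) (e : hom Z' Z) (x : hom Z' A),
    regular_epi e /\ killed c l x /\ f ∘ x = y ∘ e.
Proof.
intros Rf Hl; induction Hl as [|i l Hi Hl IH]; intros Z y Hy.
{ destruct (regular_epi_lift HR y Rf) as (Z' & e & x & Re & Ex).
  exists Z', e, x; split; [exact Re|split; [intros i []|exact Ex]]. }
destruct (IH Z y) as (Z1 & e1 & x & Re1 & Hx & Ex).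
{ intros j Hj; apply Hy; right; exact Hj. }
destruct (joint_kernel_ex c l) as (K & k & Hk & kk & Uk).
destruct (product_ex HC A B) as (AB & p1 & p2 & pair & ext).
destruct (pair K (c i ∘ k) (f ∘ k)) as (r & r1 & r2).
destruct (image_ex HR r) as (W & e & m & Re & Hm & ->).
rewrite comp_assoc in r1, r2.
destruct (Uk _ x Hx) as [u Eu].
destruct (Uk _ (c i ∘ x)) as [v Ev].
{ intros j Hj; rewrite Forall_forall in Hi.
  rewrite comp_assoc, <- (Hi j Hj); crw (Hx j Hj); apply zero_r. }
destruct (pair Z1 (zero _ _) (y ∘ e1)) as (t & t1 & t2).
destruct (difunctional (proj1 HX) (a := e ∘ u) (b := e ∘ v)
  (c := e ∘ zero _ _) (d := t) ext pair Hm) as (w & Ew).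
- crw r1; crw Eu; crw Ev; crw (cc i); reflexivity.
- crw r2; crw Ev; crw (fc i); crw Ex; crw (Hy i (or_introl eq_refl)).
  rewrite zero_l, !zero_r; reflexivity.
- rewrite t1; crw r1; rewrite zero_r; reflexivity.
- rewrite t2; crw r2; crw Eu; symmetry; exact Ex.
- destruct (regular_epi_lift HR w Re) as (Z2 & e2 & x' & Re2 & Ex').
  exists Z2, (e1 ∘ e2), (k ∘ x'); split; [|split].
  + exact (regular_epi_comp HR Re1 Re2).
  + intros j [<-|Hj]; [|exact (killed_comp _ kk Hj)].
    rewrite comp_assoc, <- r1; crw Ex'; crw Ew; crw t1; apply zero_l.
  + rewrite comp_assoc, <- r2; crw Ex'; crw Ew; crw t2; reflexivity.
Qed.

Hypothesis dd : forall i, d i ∘ d i = d i.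

(** The split short five lemma over the object [F] of fixed points of [d i], where [d i = j ∘ r];
    the section is a preimage under [f] of the generic fixed point [j]. *)
Lemma idempotent_five (i : I) :
  (forall (Z : X) (y : hom Z B), d i ∘ y = y -> exists x, c i ∘ x = x /\ f ∘ x = y) ->
  (forall (Z : X) (x : hom Z A), c i ∘ x = x -> f ∘ x = zero Z B -> x = zero Z A) ->
  (forall (Z : X) (y : hom Z B), d i ∘ y = zero Z B ->
     exists x, f ∘ x = y) ->
  (forall (Z : X) (x x' : hom Z A), c i ∘ x = zero Z A -> c i ∘ x' = zero Z A ->
     f ∘ x = f ∘ x' -> x = x') ->
  is_iso f.
Proof.
intros S1 I1 S2 I2.
destruct (equalizer_ex HC (d i) (idm B)) as (F & j & Hj & Ej & Uj).
destruct (Uj B (d i)) as [r Er]; [rewrite comp_id_l; apply dd|].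
rewrite comp_id_l in Ej.
destruct (S1 F j Ej) as (s & Es & Efs).
assert (Erj : r ∘ j = idm F).
{ apply Hj; crw Er; exact Ej. }
apply (split_short_five (proj1 HX)) with (A := F) (p := r ∘ f) (s := s) (q := r).
- crw Efs; exact Erj.
- reflexivity.
- intros Z b Eb; apply S2; rewrite <- Er; crw Eb; apply zero_r.
(* [c i ∘ a] is a fixed point of [c i] that [f] sends to zero, so the kernel of [r ∘ f] consists of
   elements killed by [c i]. *)
- assert (E : forall Z (a : hom Z A), r ∘ f ∘ a = zero Z F -> c i ∘ a = zero Z A).
  { intros Z a Ea; apply I1; [crw (cc i); reflexivity|].
    crw (fc i); rewrite <- Er; crw Ea; apply zero_r. }
  intros Z a a' E1 E2; apply I2; apply E; assumption.
Qed.

End Idempotents.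

(** The idempotents are removed from the front of the list. The first one restricts to the joint
    kernels [K] and [L] of the others, where [idempotent_five] makes the induced [g] invertible;
    this gives the last two hypotheses for the tail. *)
Lemma joint_kernel_iso (I : Type) (A B : X) (c : I -> hom A A) (d : I -> hom B B)
  (f : hom A B) (l : list I) :
  (forall i, f ∘ c i = d i ∘ f) ->
  (forall i, c i ∘ c i = c i) -> (forall i, d i ∘ d i = d i) ->
  ForallOrdPairs (fun i j => c j ∘ c i ∘ c j = c j ∘ c i) l ->
  ForallOrdPairs (fun i j => d j ∘ d i ∘ d j = d j ∘ d i) l ->
  (forall i, In i l -> forall (Z : X) (y : hom Z B), d i ∘ y = y ->
     exists x, c i ∘ x = x /\ f ∘ x = y) ->
  (forall i, In i l -> forall (Z : X) (x : hom Z A), c i ∘ x = x ->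
     f ∘ x = zero Z B -> x = zero Z A) ->
  (forall (Z : X) (y : hom Z B), killed d l y ->
     exists x, killed c l x /\ f ∘ x = y) ->
  (forall (Z : X) (x x' : hom Z A), killed c l x -> killed c l x' ->
     f ∘ x = f ∘ x' -> x = x') ->
  is_iso f.
Proof.
intros fc cc dd Hc; revert fc cc dd.
induction Hc as [|i l Hi Hl IH]; intros fc cc dd Hd S1 I1 S2 I2.
{ destruct (S2 B (idm B)) as (g & _ & Eg); [intros i []|].
  exists g; split; [|exact Eg].
  apply I2; try (intros i []); crw Eg; reflexivity. }
inversion Hd as [|i' l' Hi' Hl' E1]; subst i' l'.
assert (iso : exists (K L : X) (k : hom K A) (k' : hom L B) (g : hom K L),
  is_iso g /\ k' ∘ g = f ∘ k /\ mono k /\ killed c l k /\ mono k' /\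
  (forall (Z : X) (x : hom Z A), killed c l x -> exists h, k ∘ h = x) /\
  (forall (Z : X) (y : hom Z B), killed d l y -> exists h, k' ∘ h = y)).
{ destruct (joint_kernel_ex c l) as (K & k & Hk & kk & Uk).
  destruct (joint_kernel_ex d l) as (L & k' & Hk' & kk' & Uk').
  destruct (Uk' K (f ∘ k)) as [g Eg].
  { intros j Hj; rewrite comp_assoc, <- fc; crw (kk j Hj); apply zero_r. }
  rewrite Forall_forall in Hi, Hi'.
  destruct (Uk K (c i ∘ k)) as [ci Eci].
  { intros j Hj; rewrite comp_assoc, <- (Hi j Hj); crw (kk j Hj); apply zero_r. }
  destruct (Uk' L (d i ∘ k')) as [di Edi].
  { intros j Hj; rewrite comp_assoc, <- (Hi' j Hj); crw (kk' j Hj); apply zero_r. }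
  exists K, L, k, k', g; split; [|auto 7].
  refine (@idempotent_five unit K L (fun _ => ci) (fun _ => di) g _ _ _ tt _ _ _ _).
  - intros _; apply Hk'; crw Eg; crw Eci; crw (fc i); crw Edi; crw Eg; reflexivity.
  - intros _; apply Hk; crw Eci; crw Eci; crw (cc i); reflexivity.
  - intros _; apply Hk'; crw Edi; crw Edi; crw (dd i); reflexivity.
  - intros Z y Ey.
    destruct (S1 i (or_introl eq_refl) Z (k' ∘ y)) as (x & Ex & Efx).
    { rewrite comp_assoc, <- Edi, <- comp_assoc, Ey; reflexivity. }
    (* [x] lies in [K]: for a later [j], [c j ∘ x] is a fixed point of [c j], and [f] sends it to
       [d j ∘ k' ∘ y], which is zero. *)
    destruct (Uk Z x) as [h Eh].
    { intros j Hj; apply (I1 j (or_intror Hj)); [crw (cc j); reflexivity|].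
      crw (fc j); crw Efx; crw (kk' j Hj); apply zero_l. }
    exists h; split.
    + apply Hk; crw Eci; rewrite Eh; crw Eh; exact Ex.
    + apply Hk'; crw Eg; crw Eh; exact Efx.
  - intros Z x Ex Egx; apply Hk; rewrite zero_r.
    apply (I1 i (or_introl eq_refl)).
    + rewrite comp_assoc, <- Eci, <- comp_assoc, Ex; reflexivity.
    + rewrite comp_assoc, <- Eg, <- comp_assoc, Egx; apply zero_r.
  - intros Z y Ey.
    destruct (S2 Z (k' ∘ y)) as (x & Hx & Efx).
    { intros j [<-|Hj]; [|exact (killed_comp _ kk' Hj)].
      rewrite comp_assoc, <- Edi, <- comp_assoc, Ey; apply zero_r. }
    destruct (Uk Z x) as [h Eh]; [intros j Hj; apply Hx; right; exact Hj|].
    exists h; apply Hk'; crw Eg; crw Eh; exact Efx.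
  - intros Z x x' E1 E2 E3; apply Hk.
    assert (E : forall z : hom Z K, ci ∘ z = zero Z K -> killed c (i :: l) (k ∘ z)).
    { intros z Ez j [<-|Hj]; [|exact (killed_comp _ kk Hj)].
      rewrite comp_assoc, <- Eci, <- comp_assoc, Ez; apply zero_r. }
    apply I2; [auto|auto|].
    rewrite !comp_assoc, <- Eg, <- !comp_assoc, E3; reflexivity. }
destruct iso as (K & L & k & k' & g & (g' & gg' & g'g) & Eg & Hk & kk & Hk' & Uk & Uk').
apply IH; auto.
- intros j Hj; apply S1; right; exact Hj.
- intros j Hj; apply I1; right; exact Hj.
- intros Z y Hy; destruct (Uk' Z y Hy) as [h Eh].
  exists (k ∘ (g' ∘ h)); split; [exact (killed_comp _ kk)|].
  rewrite comp_assoc, <- Eg; crw g'g; exact Eh.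
- intros Z x x' Hx Hx' E.
  destruct (Uk Z x Hx) as [h Eh], (Uk Z x' Hx') as [h' Eh'].
  rewrite <- Eh, <- Eh' in E |- *; f_equal.
  rewrite !comp_assoc, <- Eg, <- !comp_assoc in E; apply Hk' in E.
  rewrite <- (comp_id_l h), <- (comp_id_l h'), <- gg', <- !comp_assoc, E.
  reflexivity.
Qed.

End Semiabelian.

(** * Ends, coends and the adjunction *)

(** A relation that is functional in both directions treats the two sides symmetrically, and
    naturality can be checked on it without computing the chosen transposes. *)
Lemma adjoint_of_correspondence (C E : category) (F : functor C E)
  (G : functor E C) (rel : forall c d, hom (F c) d -> hom c (G d) -> Prop) :
  (forall c d f, exists! g, rel c d f g) ->
  (forall c d g, exists! f, rel c d f g) ->
  (forall c c' d d' (a : hom c' c) (b : hom d d') f g, rel c d f g ->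
     rel c' d' (b ∘ f ∘ fmap F a) (fmap G b ∘ g ∘ a)) ->
  adjoint F G.
Proof.
intros H1 H2 H3.
pose (phi c d f := constructive_indefinite_description _ (H1 c d f)).
pose (psi c d g := constructive_indefinite_description _ (H2 c d g)).
exists (fun c d f => proj1_sig (phi c d f)), (fun c d g => proj1_sig (psi c d g)).
split; [|split].
- intros c d f; destruct (psi c d _) as [f' [Hf' u]]; simpl.
  apply u; exact (proj1 (proj2_sig (phi c d f))).
- intros c d g; destruct (phi c d _) as [g' [Hg' u]]; simpl.
  apply u; exact (proj1 (proj2_sig (psi c d g))).
- intros c c' d d' a b f; destruct (phi c' d' _) as [g' [Hg' u]]; simpl.
  apply u, H3; exact (proj1 (proj2_sig (phi c d f))).
Qed.

Section InducedFunctors.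
Variables (D : zcategory) (P : category) (M : kernel D P) (X : zcategory).

Definition cowedge (F : zfunctor D X) (B : P) (Y : X)
  (j : forall A : D, M A B -> hom (F A) Y) : Prop :=
  (forall A : D, j A (kpt M A B) = zero (F A) Y) /\
  (forall (A A' : D) (r : hom A' A) (u : M A B),
     j A' (kact M r (idm B) u) = j A u ∘ fmap F r).

Definition universal_cowedge (F : zfunctor D X) (B : P) (W : X)
  (i : forall A : D, M A B -> hom (F A) W) : Prop :=
  cowedge i /\
  forall (Y : X) (j : forall A : D, M A B -> hom (F A) Y), cowedge j ->
    exists! h : hom W Y, forall (A : D) (u : M A B), h ∘ i A u = j A u.

Definition wedge (T : functor P X) (A : D) (Y : X)
  (q : forall B : P, M A B -> hom Y (T B)) : Prop :=
  (forall B : P, q B (kpt M A B) = zero Y (T B)) /\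
  (forall (B B' : P) (f : hom B B') (u : M A B),
     q B' (kact M (idm A) f u) = fmap T f ∘ q B u).

Definition universal_wedge (T : functor P X) (A : D) (W : X)
  (p : forall B : P, M A B -> hom W (T B)) : Prop :=
  wedge p /\
  forall (Y : X) (q : forall B : P, M A B -> hom Y (T B)), wedge q ->
    exists! h : hom Y W, forall (B : P) (u : M A B), p B u ∘ h = q B u.

Lemma kact_swap (A A' : D) (B B' : P) (r : hom A' A) (f : hom B B')
  (u : M A B) :
  kact M (idm A') f (kact M r (idm B) u) = kact M r (idm B') (kact M (idm A) f u).
Proof.
rewrite <- !kact_comp, !comp_id_l, !comp_id_r; reflexivity.
Qed.

(** * Functoriality of pointwise coends *)

Section Hat.
Hypothesis coend_ex : forall (F : zfunctor D X) (B : P),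
  exists (W : X) (i : forall A : D, M A B -> hom (F A) W), universal_cowedge i.

Definition coend (F : zfunctor D X) (B : P) : X :=
  proj1_sig (constructive_indefinite_description _ (coend_ex F B)).

Definition coend_in_sig (F : zfunctor D X) (B : P) :=
  constructive_indefinite_description _
    (proj2_sig (constructive_indefinite_description _ (coend_ex F B))).

Definition coend_in (F : zfunctor D X) (B : P) (A : D) (u : M A B) :
  hom (F A) (coend F B) := proj1_sig (coend_in_sig F B) A u.

Lemma coend_universal (F : zfunctor D X) (B : P) :
  universal_cowedge (@coend_in F B).
Proof. exact (proj2_sig (coend_in_sig F B)). Qed.

Lemma coend_ext (F : zfunctor D X) (B : P) (Y : X) (h h' : hom (coend F B) Y) :
  (forall (A : D) (u : M A B), h ∘ coend_in F u = h' ∘ coend_in F u) -> h = h'.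
Proof.
intros E; destruct (coend_universal F B) as [[C1 C2] U].
destruct (U Y (fun A u => h' ∘ coend_in F u)) as (k & _ & uk).
- split; intros.
  + rewrite C1; apply zero_r.
  + rewrite C2; apply comp_assoc.
- rewrite <- (uk h E), <- (uk h'); auto.
Qed.

Definition coend_desc (F : zfunctor D X) (B : P) (Y : X)
  (j : forall A : D, M A B -> hom (F A) Y) (Hj : cowedge j) :
  { h : hom (coend F B) Y | forall (A : D) (u : M A B), h ∘ coend_in F u = j A u }.
Proof.
apply constructive_indefinite_description.
destruct (proj2 (coend_universal F B) Y j Hj) as (h & Hh & _); eauto.
Qed.

Lemma coend_map_cowedge (F : zfunctor D X) (B B' : P) (f : hom B B') :
  cowedge (fun (A : D) (u : M A B) => coend_in F (kact M (idm A) f u)).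
Proof.
destruct (coend_universal F B') as [[C1 C2] _]; split.
- intros A; rewrite kact_pt; apply C1.
- intros A A' r u; rewrite kact_swap; apply C2.
Qed.

Definition coend_map (F : zfunctor D X) (B B' : P) (f : hom B B') :
  hom (coend F B) (coend F B') :=
  proj1_sig (coend_desc (coend_map_cowedge F f)).

Lemma coend_map_in (F : zfunctor D X) (B B' : P) (f : hom B B') (A : D)
  (u : M A B) :
  coend_map F f ∘ coend_in F u = coend_in F (kact M (idm A) f u).
Proof. exact (proj2_sig (coend_desc (coend_map_cowedge F f)) A u). Qed.

Definition hat_ob (F : zfunctor D X) : functor P X.
Proof.
refine (@Functor P X (coend F) (@coend_map F) _ _).
- intros B; apply coend_ext; intros A u.
  rewrite coend_map_in, kact_id, comp_id_l; reflexivity.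
- intros B B' B'' g f; apply coend_ext; intros A u.
  rewrite <- comp_assoc, !coend_map_in, <- kact_comp, comp_id_l; reflexivity.
Defined.

Lemma hat_map_cowedge (F G : zfunctor D X) (t : nat_trans F G) (B : P) :
  cowedge (fun (A : D) (u : M A B) => coend_in G u ∘ t A).
Proof.
destruct (coend_universal G B) as [[C1 C2] _]; split.
- intros A; etransitivity; [exact (f_equal (fun x => x ∘ t A) (C1 A))|].
  apply zero_l.
- intros A A' r u.
  etransitivity; [exact (f_equal (fun x => x ∘ t A') (C2 A A' r u))|].
  rewrite <- !comp_assoc, naturality; reflexivity.
Qed.

Definition hat_app (F G : zfunctor D X) (t : nat_trans F G) (B : P) :
  hom (coend F B) (coend G B) := proj1_sig (coend_desc (hat_map_cowedge t B)).

Lemma hat_app_in (F G : zfunctor D X) (t : nat_trans F G) (A : D) (B : P)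
  (u : M A B) :
  hat_app t B ∘ coend_in F u = coend_in G u ∘ t A.
Proof. exact (proj2_sig (coend_desc (hat_map_cowedge t B)) A u). Qed.

Definition hat_map (F G : zfunctor D X) (t : nat_trans F G) :
  nat_trans (hat_ob F) (hat_ob G).
Proof.
refine (@NatTrans P X (hat_ob F) (hat_ob G) (hat_app t) _).
intros B B' f; apply coend_ext; intros A u; simpl.
rewrite <- !comp_assoc, coend_map_in, !hat_app_in, !comp_assoc, coend_map_in.
reflexivity.
Defined.

Definition hat : functor (zfunctor_cat D X) (functor_cat P X).
Proof.
refine (@Functor (zfunctor_cat D X) (functor_cat P X) hat_ob hat_map _ _).
- intros F; apply nat_trans_eq; intros B; apply coend_ext; intros A u; simpl.
  rewrite hat_app_in, comp_id_l; apply comp_id_r.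
- intros F G K t s; apply nat_trans_eq; intros B; apply coend_ext; intros A u.
  simpl; rewrite <- comp_assoc, !hat_app_in, comp_assoc, hat_app_in; simpl.
  apply comp_assoc.
Defined.

Lemma hat_is_hat : is_hat M hat.
Proof.
exists coend_in; repeat split.
- intros F B; apply coend_universal.
- intros F B; apply coend_universal.
- intros; symmetry; apply coend_map_in.
- intros; apply hat_app_in.
- intros F B Y j H1 H2; apply coend_universal; split; assumption.
Qed.

End Hat.

(** * Functoriality of pointwise ends *)

Section Tilde.
Hypothesis end_ex : forall (T : functor P X) (A : D),
  exists (W : X) (p : forall B : P, M A B -> hom W (T B)), universal_wedge p.

Definition end_ob (T : functor P X) (A : D) : X :=
  proj1_sig (constructive_indefinite_description _ (end_ex T A)).

Definition end_out_sig (T : functor P X) (A : D) :=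
  constructive_indefinite_description _
    (proj2_sig (constructive_indefinite_description _ (end_ex T A))).

Definition end_out (T : functor P X) (A : D) (B : P) (u : M A B) :
  hom (end_ob T A) (T B) := proj1_sig (end_out_sig T A) B u.

Lemma end_universal (T : functor P X) (A : D) :
  universal_wedge (@end_out T A).
Proof. exact (proj2_sig (end_out_sig T A)). Qed.

Lemma end_ext (T : functor P X) (A : D) (Y : X) (h h' : hom Y (end_ob T A)) :
  (forall (B : P) (u : M A B), end_out T u ∘ h = end_out T u ∘ h') -> h = h'.
Proof.
intros E; destruct (end_universal T A) as [[C1 C2] U].
destruct (U Y (fun B u => end_out T u ∘ h')) as (k & _ & uk).
- split; intros.
  + rewrite C1; apply zero_l.
  + rewrite C2; symmetry; apply comp_assoc.
- rewrite <- (uk h E), <- (uk h'); auto.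
Qed.

Definition end_desc (T : functor P X) (A : D) (Y : X)
  (q : forall B : P, M A B -> hom Y (T B)) (Hq : wedge q) :
  { h : hom Y (end_ob T A) | forall (B : P) (u : M A B), end_out T u ∘ h = q B u }.
Proof.
apply constructive_indefinite_description.
destruct (proj2 (end_universal T A) Y q Hq) as (h & Hh & _); eauto.
Qed.

Lemma end_map_wedge (T : functor P X) (A A' : D) (r : hom A' A) :
  wedge (fun (B : P) (u : M A B) => end_out T (kact M r (idm B) u)).
Proof.
destruct (end_universal T A') as [[C1 C2] _]; split.
- intros B; rewrite kact_pt; apply C1.
- intros B B' f u; rewrite <- kact_swap; apply C2.
Qed.

Definition end_map (T : functor P X) (A A' : D) (r : hom A' A) :
  hom (end_ob T A') (end_ob T A) :=
  proj1_sig (end_desc (end_map_wedge T r)).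

Lemma end_map_out (T : functor P X) (A A' : D) (r : hom A' A) (B : P)
  (u : M A B) :
  end_out T u ∘ end_map T r = end_out T (kact M r (idm B) u).
Proof.
exact (proj2_sig (end_desc (end_map_wedge T r)) B u).
Qed.

Definition tilde_ob (T : functor P X) : zfunctor D X.
Proof.
unshelve refine (@ZFunctor D X (@Functor D X (end_ob T)
  (fun A B r => end_map T r) _ _) _).
- intros A; apply end_ext; intros B u.
  rewrite end_map_out, kact_id, comp_id_r; reflexivity.
- intros A A' A'' g f; apply end_ext; intros B u.
  rewrite comp_assoc, !end_map_out, <- kact_comp, comp_id_l; reflexivity.
- intros A A'; apply end_ext; intros B u; simpl.
  rewrite end_map_out, kact_zero, zero_r.
  apply (end_universal T A).
Defined.

Lemma tilde_map_wedge (T U : functor P X) (t : nat_trans T U) (A : D) :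
  wedge (fun (B : P) (u : M A B) => t B ∘ end_out T u).
Proof.
destruct (end_universal T A) as [[C1 C2] _]; split.
- intros B; rewrite C1; apply zero_r.
- intros B B' f u; rewrite C2, !comp_assoc, naturality; reflexivity.
Qed.

Definition tilde_app (T U : functor P X) (t : nat_trans T U) (A : D) :
  hom (end_ob T A) (end_ob U A) := proj1_sig (end_desc (tilde_map_wedge t A)).

Lemma tilde_app_out (T U : functor P X) (t : nat_trans T U) (A : D) (B : P)
  (u : M A B) :
  end_out U u ∘ tilde_app t A = t B ∘ end_out T u.
Proof. exact (proj2_sig (end_desc (tilde_map_wedge t A)) B u). Qed.

Definition tilde_map (T U : functor P X) (t : nat_trans T U) :
  nat_trans (tilde_ob T) (tilde_ob U).
Proof.
refine (@NatTrans D X (tilde_ob T) (tilde_ob U) (tilde_app t) _).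
intros A A' r; apply end_ext; intros B u; simpl.
rewrite !comp_assoc, tilde_app_out, end_map_out, tilde_app_out, <- comp_assoc.
rewrite end_map_out; reflexivity.
Defined.

Definition tilde : functor (functor_cat P X) (zfunctor_cat D X).
Proof.
refine (@Functor (functor_cat P X) (zfunctor_cat D X) tilde_ob tilde_map _ _).
- intros T; apply nat_trans_eq; intros A; apply end_ext; intros B u; simpl.
  rewrite tilde_app_out, comp_id_r; apply comp_id_l.
- intros T U V t s; apply nat_trans_eq; intros A; apply end_ext; intros B u.
  simpl; rewrite comp_assoc, !tilde_app_out, <- comp_assoc, tilde_app_out.
  simpl; symmetry; apply comp_assoc.
Defined.

Lemma tilde_is_tilde : is_tilde M tilde.
Proof.
exists end_out; repeat split.
- intros T A; apply end_universal.
- intros T A; apply end_universal.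
- intros; symmetry; apply end_map_out.
- intros; apply tilde_app_out.
- intros T A Y q H1 H2; apply end_universal; split; assumption.
Qed.

End Tilde.

(** Here [f] and [g] correspond when they induce the same family [F A -> T B], indexed by [u] in
    [M A B]. For fixed [A] the family of [f] is a wedge and determines [g A]; for fixed [B] the
    family of [g] is a cowedge and determines [f B]. *)
Lemma hat_tilde_adjoint (Mh : functor (zfunctor_cat D X) (functor_cat P X))
  (Mt : functor (functor_cat P X) (zfunctor_cat D X)) :
  is_hat M Mh -> is_tilde M Mt -> adjoint Mh Mt.
Proof.
intros (i & i0 & ir & ib & it & iu) (p & p0 & pb & pr & pt & pu).
apply adjoint_of_correspondence with
  (rel := fun (F : zfunctor D X) (T : functor P X)
    (f : nat_trans (Mh F : functor P X) T)
    (g : nat_trans F (Mt T : zfunctor D X)) =>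
    forall (A : D) (B : P) (u : M A B), p T A B u ∘ g A = f B ∘ i F B A u).
- intros F T f.
  assert (Hw : forall A : D, wedge (fun (B : P) (u : M A B) => f B ∘ i F B A u)).
  { intros A; split.
    - intros B; rewrite i0; apply zero_r.
    - intros B B' b u; rewrite ib, !comp_assoc, naturality; reflexivity. }
  pose (g A := constructive_indefinite_description _
    (pu T A _ _ (proj1 (Hw A)) (proj2 (Hw A)))).
  assert (nat : forall (A A' : D) (r : hom A A'),
    proj1_sig (g A') ∘ fmap F r = fmap (Mt T : zfunctor D X) r ∘ proj1_sig (g A)).
  { intros A A' r; destruct (g A) as [gA [HA uA]], (g A') as [gA' [HA' uA']]; simpl.
    (* Both sides of the naturality square are the map that this wedge induces into the end at
       [A']. *)
    destruct (pu T A' _ (fun B u => f B ∘ i F B A' u ∘ fmap F r)) as (k & _ & uk).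
    - intros B; rewrite i0, zero_r; apply zero_l.
    - intros B B' b u; rewrite ib, !comp_assoc, naturality; reflexivity.
    - rewrite <- (uk (gA' ∘ fmap F r)), <- (uk (fmap (Mt T : zfunctor D X) r ∘ gA));
        [reflexivity| |]; intros B u.
      + rewrite comp_assoc, <- pr, HA, ir; apply comp_assoc.
      + rewrite comp_assoc, HA'; reflexivity. }
  exists (@NatTrans D X F (Mt T : zfunctor D X) (fun A => proj1_sig (g A)) nat).
  split.
  + intros A B u; simpl; destruct (g A) as [gA [HA uA]]; apply HA.
  + intros g' Hg'; apply nat_trans_eq; intros A; simpl.
    destruct (g A) as [gA [HA uA]]; apply uA, Hg'.
- intros F T g.
  assert (Hw : forall B : P, cowedge (fun (A : D) (u : M A B) => p T A B u ∘ g A)).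
  { intros B; split.
    - intros A; rewrite p0; apply zero_l.
    - intros A A' r u; rewrite pr, <- !comp_assoc, naturality; reflexivity. }
  pose (f B := constructive_indefinite_description _
    (iu F B _ _ (proj1 (Hw B)) (proj2 (Hw B)))).
  assert (nat : forall (B B' : P) (b : hom B B'),
    proj1_sig (f B') ∘ fmap (Mh F : functor P X) b = fmap T b ∘ proj1_sig (f B)).
  { intros B B' b; destruct (f B) as [fB [HB uB]], (f B') as [fB' [HB' uB']]; simpl.
    destruct (iu F B _ (fun A u => fmap T b ∘ (p T A B u ∘ g A))) as (k & _ & uk).
    - intros A; rewrite p0, zero_l; apply zero_r.
    - intros A A' r u; rewrite pr, <- !comp_assoc, naturality; reflexivity.
    - rewrite <- (uk (fB' ∘ fmap (Mh F : functor P X) b)),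
        <- (uk (fmap T b ∘ fB)); [reflexivity| |]; intros A u.
      + rewrite <- comp_assoc, HB; reflexivity.
      + rewrite <- comp_assoc, <- ib, HB', pb; symmetry; apply comp_assoc. }
  exists (@NatTrans P X (Mh F : functor P X) T (fun B => proj1_sig (f B)) nat).
  split.
  + intros A B u; simpl; destruct (f B) as [fB [HB uB]]; symmetry; apply HB.
  + intros f' Hf'; apply nat_trans_eq; intros B; simpl.
    destruct (f B) as [fB [HB uB]]; apply uB; intros A u; symmetry; apply Hf'.
- intros F F' T T' a b f g H A B u; simpl.
  rewrite !comp_assoc, pt, <- (comp_assoc _ (p T A B u)), H.
  rewrite <- !comp_assoc, it; reflexivity.
Qed.

End InducedFunctors.

(** * Functor categories *)

Lemma pointwise_iso (D C : category) (F G : functor D C) (t : nat_trans F G) :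
  (forall A, is_iso (t A)) -> is_iso (t : @hom (functor_cat D C) F G).
Proof.
intros It.
pose (s A := constructive_indefinite_description _ (It A)).
assert (nat : forall A B (f : hom A B),
  proj1_sig (s B) ∘ fmap G f = fmap F f ∘ proj1_sig (s A)).
{ intros A B f; destruct (s A) as [sA [A1 A2]], (s B) as [sB [B1 B2]]; simpl.
  rewrite <- (comp_id_r (fmap G f)), <- A2; crw (eq_sym (naturality t f)).
  crw B1; reflexivity. }
exists (@NatTrans D C G F (fun A => proj1_sig (s A)) nat).
split; apply nat_trans_eq; intros A; simpl; apply (proj2_sig (s A)).
Qed.

Lemma coequalizer_pointwise (D C : category) (T U Q : functor D C)
  (f g : nat_trans T U) (q : nat_trans U Q) :
  (forall A, is_coequalizer (f A) (g A) (q A)) ->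
  is_coequalizer (f : @hom (functor_cat D C) T U) g (q : @hom (functor_cat D C) U Q).
Proof.
intros Hq; split; [apply nat_trans_eq; intros A; apply (Hq A)|].
intros V h Eh.
assert (Eh' : forall A, h A ∘ f A = h A ∘ g A).
{ intros A; exact (f_equal (fun z => @nt_app D C _ _ z A) Eh). }
pose (k A := constructive_indefinite_description _ (proj2 (Hq A) (V A) (h A) (Eh' A))).
assert (nat : forall A B (u : hom A B),
  proj1_sig (k B) ∘ fmap Q u = fmap V u ∘ proj1_sig (k A)).
{ intros A B u; destruct (k A) as [kA [EA uA]], (k B) as [kB [EB uB]]; simpl.
  apply (regular_epi_epi (q := q A)); [exists (T A), (f A), (g A); apply Hq|].
  rewrite <- !comp_assoc, EA, <- naturality, comp_assoc, EB; apply naturality. }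
exists (@NatTrans D C Q V (fun A => proj1_sig (k A)) nat); split.
- apply nat_trans_eq; intros A; simpl; apply (proj2_sig (k A)).
- intros k' Ek'; apply nat_trans_eq; intros A; simpl.
  apply (proj2_sig (k A)); exact (f_equal (fun z => @nt_app D C _ _ z A) Ek').
Qed.

Lemma reflexive_pair_pointwise (D C : category) (T U : functor_cat D C)
  (f g : hom T U) (A : D) :
  reflexive_pair f g -> reflexive_pair (nt_app f A) (nt_app g A).
Proof.
intros (s & sf & sg); exists (nt_app s A); split.
- exact (f_equal (fun z => @nt_app D C _ _ z A) sf).
- exact (f_equal (fun z => @nt_app D C _ _ z A) sg).
Qed.

Lemma pointwise_reflexive_coequalizer (D C : category) (T U : functor_cat D C)
  (f g : hom T U) :
  has_reflexive_coequalizers C -> reflexive_pair f g ->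
  exists (Q : functor D C) (q : nat_trans U Q),
    forall A, is_coequalizer (nt_app f A) (nt_app g A) (q A).
Proof.
intros HC Hfg.
pose (Q A := constructive_indefinite_description _
  (HC _ _ _ _ (reflexive_pair_pointwise A Hfg))).
pose (q A := constructive_indefinite_description _ (proj2_sig (Q A))).
pose (Qo A := proj1_sig (Q A)).
pose (qm A := proj1_sig (q A) : hom (fob U A) (Qo A)).
assert (Hq : forall A, is_coequalizer (nt_app f A) (nt_app g A) (qm A)).
{ intros A; exact (proj2_sig (q A)). }
assert (Qf : forall A B (u : hom A B),
  exists k : hom (Qo A) (Qo B), k ∘ qm A = qm B ∘ fmap U u).
{ intros A B u; destruct (proj2 (Hq A) (Qo B) (qm B ∘ fmap U u)) as (k & Ek & _).
  - rewrite <- !comp_assoc, <- !naturality, !comp_assoc.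
    rewrite (proj1 (Hq B)); reflexivity.
  - exists k; exact Ek. }
pose (Qm A B u := proj1_sig (constructive_indefinite_description _ (Qf A B u))).
assert (EQ : forall A B u, Qm A B u ∘ qm A = qm B ∘ fmap U u).
{ intros A B u; exact (proj2_sig (constructive_indefinite_description _ (Qf A B u))). }
assert (ext : forall A (Y : C) (u v : hom (Qo A) Y), u ∘ qm A = v ∘ qm A -> u = v).
{ intros A Y u v; apply regular_epi_epi; exists (fob T A), (nt_app f A), (nt_app g A).
  apply Hq. }
unshelve refine (let Q' := @Functor D C Qo Qm _ _ in
  ex_intro _ Q' (ex_intro _ (@NatTrans D C U Q' qm _) Hq)).
- intros A; apply ext; rewrite EQ, fmap_id, comp_id_l; apply comp_id_r.
- intros A B E h k; apply ext; rewrite EQ, fmap_comp; crw (EQ A B k).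
  crw (EQ B E h); reflexivity.
- intros A B u; symmetry; apply EQ.
Qed.

Lemma functor_cat_reflexive_coequalizers (D C : category) :
  has_reflexive_coequalizers C -> has_reflexive_coequalizers (functor_cat D C).
Proof.
intros HC T U f g Hfg.
destruct (pointwise_reflexive_coequalizer HC Hfg) as (Q & q & Hq).
exists Q, q; apply coequalizer_pointwise, Hq.
Qed.

(** The pointwise coequalizer [q'] exists, and its comparisons with [q] satisfy [b ∘ a = idm Q],
    which transfers the universal property of each [q' A] to [q] at [A]. *)
Lemma pointwise_of_coequalizer (D C : category) (T U Q : functor_cat D C)
  (f g : hom T U) (q : hom U Q) :
  has_reflexive_coequalizers C -> reflexive_pair f g -> is_coequalizer f g q ->
  forall A, is_coequalizer (nt_app f A) (nt_app g A) (nt_app q A).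
Proof.
intros HC Hfg [Eq Uq] A.
destruct (pointwise_reflexive_coequalizer HC Hfg) as (Q' & q' & Hq').
destruct (coequalizer_pointwise Hq') as [Eq' Uq'].
destruct (Uq Q' q' Eq') as (a & Ea & _), (Uq' Q q Eq) as (b & Eb & _).
assert (Eab : b ∘ a = idm Q).
{ destruct (Uq Q q Eq) as (k & _ & uk).
  rewrite <- (uk (b ∘ a)), <- (uk (idm Q)); [reflexivity|apply comp_id_l|].
  rewrite <- comp_assoc, Ea; exact Eb. }
assert (aq : nt_app a A ∘ nt_app q A = q' A)
  by exact (f_equal (fun z => @nt_app D C _ _ z A) Ea).
assert (bq : nt_app b A ∘ q' A = nt_app q A)
  by exact (f_equal (fun z => @nt_app D C _ _ z A) Eb).
assert (ba : nt_app b A ∘ nt_app a A = idm _)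
  by exact (f_equal (fun z => @nt_app D C _ _ z A) Eab).
destruct (Hq' A) as [E U']; split.
- rewrite <- bq, <- !comp_assoc, E; reflexivity.
- intros Y h Eh; destruct (U' Y h Eh) as (k & Ek & uk).
  exists (k ∘ nt_app a A); split; [crw aq; exact Ek|].
  intros k' Ek'; rewrite (uk (k' ∘ nt_app b A)); [crw ba; reflexivity|].
  crw bq; exact Ek'.
Qed.

(** * Subobjects *)

Lemma is_iso_comp (C : category) (A B E : C) (g : hom B E) (f : hom A B) :
  is_iso g -> is_iso f -> is_iso (g ∘ f).
Proof.
intros (g' & g1 & g2) (f' & f1 & f2); exists (f' ∘ g'); split.
- crw g1; exact f1.
- crw f2; exact g2.
Qed.

Section Subobjects.
Variables (P : category) (S : star_data P).

Lemma inM_mono (A B : P) (m : hom A B) : inM S m -> mono m.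
Proof. intros h; exact (split_mono (star_mul h)). Qed.

Lemma inR_iso_l (A B C : P) (r : hom A B) (a : hom B C) :
  is_iso a -> inR S r -> inR S (a ∘ r).
Proof.
intros (b & ba & ab) HR C' D m x n hm hn E.
assert (hb : inM S b) by (apply inM_iso; exists a; auto).
destruct (HR C' D (b ∘ m) x n (inM_comp hb hm) hn) as [im ir].
{ rewrite <- !comp_assoc, (comp_assoc m), <- E; crw ba; reflexivity. }
split; [|exact ir].
replace m with (a ∘ (b ∘ m)) by (crw ab; reflexivity).
apply is_iso_comp; [exists b; auto|exact im].
Qed.

Lemma sub_iso_refl (A : P) (m : sub S A) : sub_iso m m.
Proof.
exists (idm _); rewrite comp_id_r; split; [|reflexivity].
exists (idm _); rewrite comp_id_l; auto.
Qed.

Lemma sub_iso_sym (A : P) (m n : sub S A) : sub_iso m n -> sub_iso n m.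
Proof.
intros (f & (g & g1 & g2) & E); exists g; split; [exists f; auto|].
rewrite E; crw g2; reflexivity.
Qed.

Lemma sub_iso_trans (A : P) (m n k : sub S A) :
  sub_iso m n -> sub_iso n k -> sub_iso m k.
Proof.
intros (f & If & E) (g & Ig & E'); exists (g ∘ f); split.
- apply is_iso_comp; assumption.
- rewrite E, E'; symmetry; apply comp_assoc.
Qed.

Lemma sub_le_refl (A : P) (m : sub S A) : sub_le m m.
Proof. exists (idm _); rewrite comp_id_r; reflexivity. Qed.

Lemma sub_le_trans (A : P) (m n k : sub S A) :
  sub_le m n -> sub_le n k -> sub_le m k.
Proof.
intros (f & E) (g & E'); exists (g ∘ f).
rewrite E, E'; symmetry; apply comp_assoc.
Qed.

Lemma sub_iso_le (A : P) (m n : sub S A) : sub_iso m n -> sub_le m n.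
Proof. intros (f & _ & E); exists f; exact E. Qed.

Lemma sub_le_antisym (A : P) (m n : sub S A) :
  sub_le m n -> sub_le n m -> sub_iso m n.
Proof.
intros (f & E) (g & E'); exists f; split; [|exact E]; exists g; split.
- apply (inM_mono (sub_in m)); crw (eq_sym E'); rewrite <- E; reflexivity.
- apply (inM_mono (sub_in n)); crw (eq_sym E); rewrite <- E'; reflexivity.
Qed.

Lemma sub_iso_proper (A : P) (m n : sub S A) :
  sub_iso m n -> proper m -> proper n.
Proof.
intros (f & If & E) Hm Hn; apply Hm; rewrite E; apply is_iso_comp; assumption.
Qed.

(** Such a list meets every element of [Sub A], possibly repeatedly. Its length replaces the
    cardinality of [Sub A] as induction measure. *)
Definition covers (A : P) (l : list (sub S A)) : Prop :=
  forall m, exists n, In n l /\ sub_iso m n.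

Definition sub_image (U B : P) (m : hom U B) (hm : inM S m) (k : sub S U) :
  sub S B :=
  @Sub P S B (sub_dom k) (m ∘ sub_mor k) (inM_comp hm (sub_in k)).

Lemma sub_image_iso (U B : P) (m : hom U B) (hm : inM S m) (k k' : sub S U) :
  sub_iso (sub_image hm k) (sub_image hm k') -> sub_iso k k'.
Proof.
intros (f & If & E); exists f; split; [exact If|].
apply (inM_mono hm); simpl in E; rewrite E; symmetry; apply comp_assoc.
Qed.

(** One preimage is kept for each entry of [l] in the image of composition with [m]; one is enough
    because this composition is injective on subobjects, by [sub_image_iso]. *)
Lemma pull_list (U B : P) (m : hom U B) (hm : inM S m) (l : list (sub S B)) :
  exists l' : list (sub S U), length l' <= length l /\
    forall k n, In n l -> sub_iso (sub_image hm k) n ->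
    exists n', In n' l' /\ sub_iso k n'.
Proof.
induction l as [|a l (l' & Hl & H)].
- exists []; split; [apply le_n|intros k n []].
- destruct (classic (exists k, sub_iso (sub_image hm k) a)) as [[k0 Hk0]|no].
  + exists (k0 :: l'); split; [apply le_n_S, Hl|].
    intros k n [<-|Hn] Hk.
    * exists k0; split; [left; reflexivity|].
      apply (sub_image_iso (hm := hm)).
      exact (sub_iso_trans Hk (sub_iso_sym Hk0)).
    * destruct (H k n Hn Hk) as (n' & Hn' & I); exists n'; simpl; auto.
  + exists l'; split; [apply le_S, Hl|].
    intros k n [<-|Hn] Hk; [exfalso; eauto|exact (H k n Hn Hk)].
Qed.

(** Composition with [m] embeds [Sub U] into [Sub B] and misses the identity of [B]: if [m ∘ k]
    represented it, [m] would have a right inverse and be invertible. So an entry for the identity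
    is removed before the list is pulled back. *)
Lemma proper_covers (U B : P) (m : hom U B) (hm : inM S m) (l : list (sub S B)) :
  ~ is_iso m -> covers l ->
  exists l' : list (sub S U), length l' < length l /\ covers l'.
Proof.
intros nm Hl.
destruct (Hl (@Sub P S B B (idm B) (inM_id S B))) as (a & Ha & Ia).
destruct (in_split _ _ Ha) as (l1 & l2 & El).
destruct (pull_list hm (l1 ++ l2)) as (l' & Hl' & H).
exists l'; split.
- rewrite El, length_app; rewrite length_app in Hl'; simpl.
  rewrite <- plus_n_Sm; apply le_n_S, Hl'.
- intros k; destruct (Hl (sub_image hm k)) as (n & Hn & In).
  rewrite El in Hn; apply in_app_or in Hn; simpl in Hn.
  destruct Hn as [Hn|[<-|Hn]].
  + apply (H k n); [apply in_or_app; auto|exact In].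
  + exfalso; apply nm.
    destruct (sub_iso_trans In (sub_iso_sym Ia)) as (f & (g & _ & g2) & E).
    simpl in f, g, g2, E; rewrite comp_id_l in E.
    apply split_iso with (S := S) (g := sub_mor k ∘ g); [exact hm|].
    rewrite comp_assoc, E; exact g2.
  + apply (H k n); [apply in_or_app; auto|exact In].
Qed.

(** The search climbs along the list: when the head [a] is proper and above the [n] found in the
    tail, the tail is searched again starting from [a]. *)
Lemma below_maximal_in (A : P) (l : list (sub S A)) (m : sub S A) :
  proper m -> exists n, proper n /\ sub_le m n /\
    forall k, In k l -> proper k -> sub_le n k -> sub_le k n.
Proof.
revert m; induction l as [|a l IH]; intros m Hm.
- exists m; split; [exact Hm|split; [apply sub_le_refl|intros k []]].
- destruct (IH m Hm) as (n & Hn & mn & Un).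
  destruct (classic (proper a /\ sub_le n a)) as [[Ha na]|no].
  + destruct (IH a Ha) as (n' & Hn' & an' & Un').
    exists n'; split; [exact Hn'|split].
    * exact (sub_le_trans mn (sub_le_trans na an')).
    * intros k [<-|Hk] Pk n'k; [exact an'|auto].
  + exists n; split; [exact Hn|split; [exact mn|]].
    intros k [<-|Hk] Pk nk; [exfalso; auto|auto].
Qed.

Lemma below_maximal (A : P) (l : list (sub S A)) (m : sub S A) :
  covers l -> proper m -> exists n, maximal_proper n /\ sub_le m n.
Proof.
intros Hl Hm; destruct (below_maximal_in l Hm) as (n & Hn & mn & Un).
exists n; split; [split; [exact Hn|]|exact mn].
intros k Hk nk; destruct (Hl k) as (k' & Hk' & I).
apply sub_le_antisym; [exact nk|].
apply (sub_le_trans (sub_iso_le I)), Un; [exact Hk'| |].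
- exact (sub_iso_proper I Hk).
- exact (sub_le_trans nk (sub_iso_le I)).
Qed.

(** One representative is kept per subobject, so that the coproduct that computes the coend has one
    summand for each. *)
Lemma covers_distinct (A : P) (l : list (sub S A)) :
  exists l' : list (sub S A),
    (forall n, In n l -> exists n', In n' l' /\ sub_iso n n') /\
    ForallOrdPairs (fun m n => ~ sub_iso m n) l'.
Proof.
induction l as [|a l (l' & H & D)].
- exists []; split; [intros n []|constructor].
- destruct (classic (exists n, In n l' /\ sub_iso a n)) as [yes|no].
  + exists l'; split; [|exact D].
    intros n [<-|Hn]; [exact yes|exact (H n Hn)].
  + exists (a :: l'); split.
    * intros n [<-|Hn]; [exists a; split; [left; auto|apply sub_iso_refl]|].
      destruct (H n Hn) as (n' & Hn' & I); exists n'; simpl; auto.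
    * constructor; [|exact D]; apply Forall_forall; intros n Hn I.
      apply no; eauto.
Qed.

End Subobjects.

Lemma finite_sig_In (T : Type) (l : list T) : finite_type { x | In x l }.
Proof.
induction l as [|a l [L HL]].
- exists []; intros [x []].
- exists (exist _ a (or_introl eq_refl) ::
    map (fun x => exist _ (proj1_sig x) (or_intror (proj2_sig x))) L).
  intros [x [<-|Hx]]; [left; reflexivity|right].
  apply in_map_iff; exists (exist _ x Hx); split; [|apply HL].
  apply sig_eq; reflexivity.
Qed.

(** * The kernel M *)

Section Kernel.
Variables (P : category) (S : star_data P) (H : conditions S) (X : zcategory).

(** These are the elements of the intersection of the kernels of [T k^*] over proper [k], which is
    the value of the end at [A]. *)
Definition normal (T : functor P X) (A : P) (Z : X) (x : hom Z (T A)) : Prop :=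
  forall (C : P) (k : hom C A) (hk : inM S k), ~ is_iso k ->
    fmap T (star hk) ∘ x = zero Z (T C).

Lemma normal_comp (T : functor P X) (A : P) (Z Z' : X) (x : hom Z (T A))
  (z : hom Z' Z) : normal x -> normal (x ∘ z).
Proof. intros N C k hk nk; crw (N C k hk nk); apply zero_l. Qed.

(** By [comp_mstar], [f = m^* ∘ k] has the form [p ∘ q^*]. As [k^* ∘ m] is a retraction of it, [q^*]
    is a split mono, so [q] is invertible and [p ∘ q^*] lies in [inM]. *)
Lemma inM_cancel (A B C : P) (k : hom C A) (m : hom B A) (f : hom C B) :
  inM S k -> inM S m -> k = m ∘ f -> inM S f.
Proof.
intros hk hm E.
assert (Ef : f = star hm ∘ k) by (rewrite E; crw (star_mul hm); reflexivity).
destruct (comp_mstar H (n := idm C) (m := k) (n' := m) (m' := idm B)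
  (inM_id S C) hm hk (inM_id S B)) as (F & q & p & hq & hp & Epq).
rewrite star_id, comp_id_l, comp_id_r, <- Ef in Epq.
assert (iq : is_iso q).
{ apply (cosplit_iso (S := S)) with (h := hq) (g := star hk ∘ m ∘ p).
  rewrite <- !comp_assoc, <- Epq, <- E; apply star_mul. }
rewrite Epq; apply inM_comp; [exact hp|].
apply inM_iso; exists q; destruct (is_iso_inv_star hq iq); auto.
Qed.

(** Every proper [k] factors as [m ∘ f] through a maximal proper [m]; then [f] lies in [inM] by
    [inM_cancel], and [k^* = f^* ∘ m^*]. *)
Lemma normal_of_maximal (T : functor P X) (A : P) (Z : X) (x : hom Z (T A)) :
  (forall m : sub S A, maximal_proper m -> fmap T (star (sub_in m)) ∘ x = zero _ _) ->
  normal x.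
Proof.
intros N C k hk nk; destruct (sub_finite H A) as [l Hl].
destruct (below_maximal (m := Sub hk) Hl nk) as (m & Hm & f & Ef); simpl in f, Ef.
pose proof (inM_cancel hk (sub_in m) Ef) as hf.
assert (E : star hk = star hf ∘ star (sub_in m)).
{ subst k; rewrite <- (star_comp (sub_in m) hf hk); reflexivity. }
rewrite E, fmap_comp, <- comp_assoc, N, zero_r; [reflexivity|exact Hm].
Qed.

Lemma fmap_idem (T : functor P X) (A : P) (m : sub S A) :
  fmap T (idem m) = fmap T (sub_mor m) ∘ fmap T (star (sub_in m)).
Proof. apply fmap_comp. Qed.

Lemma fmap_star_mul (T : functor P X) (A : P) (m : sub S A) :
  fmap T (star (sub_in m)) ∘ fmap T (sub_mor m) = idm _.
Proof. rewrite <- fmap_comp, star_mul; apply fmap_id. Qed.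

Lemma idem_zero (T : functor P X) (A : P) (m : sub S A) (Z : X)
  (x : hom Z (T A)) :
  fmap T (idem m) ∘ x = zero _ _ <-> fmap T (star (sub_in m)) ∘ x = zero _ _.
Proof.
rewrite fmap_idem; split; intros E.
- rewrite <- (comp_id_l (fmap T (star (sub_in m)))), <- (fmap_star_mul T m).
  rewrite <- !comp_assoc in *; rewrite E; apply zero_r.
- rewrite <- comp_assoc, E; apply zero_r.
Qed.

Lemma idem_idem (T : functor P X) (A : P) (m : sub S A) :
  fmap T (idem m) ∘ fmap T (idem m) = fmap T (idem m).
Proof. rewrite fmap_idem; crw (fmap_star_mul T m); reflexivity. Qed.

(** This moves [maximal_list] into [X]: normal elements become the joint kernel of a list of
    idempotents, in the form that [joint_kernel_cover] and [joint_kernel_iso] take. *)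
Lemma maximal_list_functor (A : P) : exists l : list (sub S A),
  (forall m, In m l -> proper m) /\
  (forall T : functor P X,
     ForallOrdPairs (fun i j => fmap T (idem j) ∘ fmap T (idem i) ∘ fmap T (idem j)
       = fmap T (idem j) ∘ fmap T (idem i)) l) /\
  (forall (T : functor P X) (Z : X) (x : hom Z (T A)),
     normal x <-> killed (fun m => fmap T (idem m)) l x).
Proof.
destruct (maximal_list H A) as (l & lm & ml & _ & Hl).
exists l; split; [intros m Hm; apply lm, Hm|split].
- intros T; clear lm ml; induction Hl as [|i l Hi _ IH]; constructor.
  + apply Forall_forall; intros j Hj; rewrite Forall_forall in Hi.
    rewrite <- !fmap_comp, (Hi j Hj); reflexivity.
  + exact IH.
- intros T Z x; split.
  + intros N m Hm; apply idem_zero, N, (lm m Hm).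
  + intros K; apply normal_of_maximal; intros m Hm.
    destruct (ml m Hm) as (n & Hn & f & (g & fg & gf) & E).
    pose proof (proj1 (idem_zero n x) (K n Hn)) as En.
    assert (hf : inM S f) by (apply inM_iso; exists g; auto).
    assert (Es : star (sub_in m) = star hf ∘ star (sub_in n)).
    { generalize (sub_in m); rewrite E; intros h; apply star_comp. }
    rewrite Es, fmap_comp, <- comp_assoc, En; apply zero_r.
Qed.

Definition unit_elt (A : P) : kernelM H A A :=
  Some (exist _ (idm A) (inR_inMR (@inR_id P S A))).

Lemma unit_elt_act (A B : P) (u : hom A B) (hu : inMR S u) :
  kact (kernelM H) (idm (A : Dcat H)) u (unit_elt A) = Some (exist _ u hu).
Proof.
simpl; rewrite !comp_id_r; apply restr_in.
Qed.

(* By the Yoneda lemma a wedge is an element of T A; it has to be killed by the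
   maps T u with u not in [inMR], which factor through noninvertible k^*. *)
Lemma wedge_normal (T : functor P X) (A : P) (Z : X)
  (q : forall B : P, kernelM H A B -> hom Z (T B)) :
  wedge (A := (A : Dcat H)) q -> normal (q A (unit_elt A)).
Proof.
intros [q0 qf] C k hk nk; rewrite <- qf; etransitivity; [|apply q0]; f_equal.
simpl; rewrite !comp_id_r; apply restr_out; intros HM; apply nk.
apply (inMR_star1 H (x := idm C) (hk := hk)); rewrite comp_id_l; exact HM.
Qed.

Lemma wedge_eq (T : functor P X) (A : P) (Z : X)
  (q : forall B : P, kernelM H A B -> hom Z (T B)) :
  wedge (A := (A : Dcat H)) q ->
  forall (B : P) (u : hom A B) (hu : inMR S u),
  q B (Some (exist _ u hu)) = fmap T u ∘ q A (unit_elt A).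
Proof. intros [q0 qf] B u hu; rewrite <- qf, (unit_elt_act hu); reflexivity. Qed.

Definition wedge_of (T : functor P X) (A : P) (Z : X) (x : hom Z (T A)) (B : P)
  (u : kernelM H A B) : hom Z (T B) :=
  match u with Some u => fmap T (proj1_sig u) ∘ x | None => zero _ _ end.

Lemma normal_not_inMR (T : functor P X) (A : P) (Z : X) (x : hom Z (T A))
  (B : P) (u : hom A B) :
  normal x -> ~ inMR S u -> fmap T u ∘ x = zero _ _.
Proof.
intros N nu; destruct (inMR_or H u) as [hu|(C & k & hk & y & nk & ->)];
  [contradiction|].
rewrite fmap_comp, <- comp_assoc, N; [apply zero_r|exact nk].
Qed.

Lemma wedge_of_wedge (T : functor P X) (A : P) (Z : X) (x : hom Z (T A)) :
  normal x -> wedge (A := (A : Dcat H)) (wedge_of x).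
Proof.
intros N; split; [reflexivity|].
intros B B' f [[u hu]|]; simpl; [|symmetry; apply zero_r].
rewrite comp_id_r; destruct (classic (inMR S (f ∘ u))) as [HM|nM].
- rewrite (restr_in HM); simpl; rewrite fmap_comp; symmetry; apply comp_assoc.
- rewrite (restr_out nM); simpl.
  rewrite comp_assoc, <- fmap_comp; symmetry; apply normal_not_inMR; assumption.
Qed.

Lemma wedge_of_unit (T : functor P X) (A : P) (Z : X) (x : hom Z (T A)) :
  wedge_of x (unit_elt A) = x.
Proof. simpl; rewrite fmap_id; apply comp_id_l. Qed.

(** Wedges at [A] with vertex [Y] correspond to normal elements [Y -> T A], and the joint kernel of
    the idempotents represents these. *)
Lemma universal_wedge_ex (HX : semiabelian X) (T : functor P X) (A : Dcat H) :
  exists (W : X) (p : forall B : P, kernelM H A B -> hom W (T B)),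
    universal_wedge p.
Proof.
destruct (maximal_list_functor A) as (l & _ & _ & Hl).
destruct (joint_kernel_ex HX (fun m : sub S A => fmap T (idem m)) l)
  as (K & k & Hk & kk & Uk).
apply Hl in kk.
exists K, (wedge_of k); split; [apply wedge_of_wedge, kk|].
intros Y q Hq; pose proof (wedge_normal Hq) as N; apply Hl in N.
destruct (Uk _ _ N) as [h Eh]; exists h; split.
- intros B [[u hu]|]; simpl.
  + rewrite <- comp_assoc, Eh; symmetry; apply (wedge_eq Hq).
  + rewrite zero_l; symmetry; apply Hq.
- intros h' Eh'; apply Hk; rewrite Eh, <- Eh', wedge_of_unit; reflexivity.
Qed.

(** The component of the universal wedge at [unit_elt A] embeds the end into [T A] as the object of
    normal elements. Conservativity and preservation of coequalizers are proved from this
    description. *)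
Lemma tilde_kernel (Mt : functor (functor_cat P X) (zfunctor_cat (Dcat H) X)) :
  is_tilde (kernelM H) Mt ->
  exists k : forall (T : functor P X) (A : P),
      hom (fob (Mt T : zfunctor (Dcat H) X) A) (T A),
    (forall T A, normal (k T A)) /\ (forall T A, mono (k T A)) /\
    (forall (T : functor P X) (A : P) (Z : X) (x : hom Z (T A)), normal x -> exists h, k T A ∘ h = x) /\
    (forall (T U : functor P X) (t : nat_trans T U) (A : P),
       k U A ∘ nt_app (fmap Mt t : nat_trans _ _) A = t A ∘ k T A).
Proof.
intros (p & p0 & pf & pr & pt & pu).
assert (Hw : forall T A, wedge (p T A)) by (split; intros; auto).
exists (fun T A => p T A A (unit_elt A)); split; [|split; [|split]].
- intros T A; exact (wedge_normal (Hw T A)).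
- intros T A Z u v E.
  destruct (pu T A Z (wedge_of (p T A A (unit_elt A) ∘ v))) as (h & _ & uh).
  { reflexivity. }
  { apply wedge_of_wedge, normal_comp, (wedge_normal (Hw T A)). }
  assert (Eq : forall w, p T A A (unit_elt A) ∘ w = p T A A (unit_elt A) ∘ v ->
    forall B m, p T A B m ∘ w = wedge_of (p T A A (unit_elt A) ∘ v) m).
  { intros w Ew B [[m hm]|]; simpl.
    - rewrite (wedge_eq (Hw T A)), <- comp_assoc, Ew; reflexivity.
    - etransitivity; [exact (f_equal (fun x => x ∘ w) (p0 T A B))|apply zero_l]. }
  rewrite <- (uh u (Eq u E)), <- (uh v (Eq v eq_refl)); reflexivity.
- intros T A Z x N.
  destruct (pu T A Z (wedge_of x)) as (h & Eh & _).
  { reflexivity. }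
  { apply wedge_of_wedge, N. }
  exists h; rewrite Eh; apply wedge_of_unit.
- intros T U t A; apply pt.
Qed.

Definition D_mor (A B : P) (r : hom A B) (Rr : inR S r) : @hom (Dcat H) A B :=
  Some (exist _ r Rr).

Lemma inMR_comp (A B C : P) (m : hom B C) (r : hom A B) :
  inM S m -> inR S r -> inMR S (m ∘ r).
Proof. intros hm Rr; exists B, r, m; auto using inR_inS. Qed.

Lemma inM_inMR (A B : P) (m : hom A B) : inM S m -> inMR S m.
Proof.
intros hm; rewrite <- (comp_id_r m); apply inMR_comp; [exact hm|apply inR_id].
Qed.

(** * The coend as a coproduct over the subobjects of [B] *)

Section Coend.
Variables (B : P) (l : list (sub S B)).
Hypothesis Hl : covers l.
Hypothesis Dl : ForallOrdPairs (fun m n => ~ sub_iso m n) l.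

(** With the uniqueness below, the nonzero elements of [M A B] are the pairs of an entry [n] of [l]
    and a nonzero morphism [A -> sub_dom n] of [D]. So [M] at [B] is a sum of representables, and by
    the Yoneda lemma its coend with [F] is the coproduct of the [F (sub_dom n)]. *)
Lemma inMR_decomp (A : P) (u : hom A B) :
  inMR S u -> exists (i : { n | In n l }) (r : hom A (sub_dom (proj1_sig i))),
    inR S r /\ u = sub_mor (proj1_sig i) ∘ r.
Proof.
intros (C & s & m & _ & hm & -> & Rs).
destruct (Hl (Sub hm)) as (n & Hn & f & If & E); simpl in f, E.
exists (exist _ n Hn), (f ∘ s); simpl; split; [apply inR_iso_l; assumption|].
rewrite E; symmetry; apply comp_assoc.
Qed.

(** By [factor_uniq] the two subobjects are isomorphic, hence equal entries of [l]; then [r = r']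
    since the subobject is mono. The pairs are compared as a whole because the type of [r] depends
    on [i]. *)
Lemma inMR_decomp_unique (A : P) (i i' : { n | In n l })
  (r : hom A (sub_dom (proj1_sig i))) (r' : hom A (sub_dom (proj1_sig i')))
  (Rr : inR S r) (Rr' : inR S r') :
  sub_mor (proj1_sig i) ∘ r = sub_mor (proj1_sig i') ∘ r' ->
  existT (fun j => { r : hom A (sub_dom (proj1_sig j)) | inR S r }) i (exist _ r Rr)
  = existT _ i' (exist _ r' Rr').
Proof.
intros E.
assert (Ei : i = i').
{ destruct (factor_uniq H (m := idm A) (m' := idm A)
    (hm := inM_id S A) (hm' := inM_id S A)
    (sub_in (proj1_sig i)) (sub_in (proj1_sig i')) Rr Rr')
    as (a & b & _ & Ib & _ & Eb & _).
  { rewrite E; reflexivity. }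
  assert (I : sub_iso (proj1_sig i) (proj1_sig i')) by (exists b; auto).
  apply sig_eq.
  destruct (ForallOrdPairs_In Dl _ _ (proj2_sig i) (proj2_sig i'))
    as [E'|[n|n]]; [exact E'|contradiction|].
  contradiction (n (sub_iso_sym I)). }
subst i'; f_equal; apply sig_eq; simpl.
exact (inM_mono (sub_in (proj1_sig i)) E).
Qed.

Variables (F : zfunctor (Dcat H) X) (W : X).
Variable c : forall i : { n | In n l }, hom (F (sub_dom (proj1_sig i))) W.
Hypothesis Hc : is_coproduct c.

(** Quantifying over all decompositions of [u] makes the formula available for any of them; they
    agree by [inMR_decomp_unique]. *)
Lemma coproduct_in_ex (A : P) (u : kernelM H A B) :
  exists v : hom (F A) W,
    (u = None -> v = zero _ _) /\
    forall i (r : hom A (sub_dom (proj1_sig i))) (Rr : inR S r),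
      option_map (@proj1_sig _ _) u = Some (sub_mor (proj1_sig i) ∘ r) ->
      v = c i ∘ fmap F (D_mor Rr).
Proof.
destruct u as [[u hu]|].
- destruct (inMR_decomp hu) as (i & r & Rr & E).
  exists (c i ∘ fmap F (D_mor Rr)); split; [discriminate|].
  intros i' r' Rr' E'; injection E'; intros E''; rewrite E in E''.
  pose proof (inMR_decomp_unique Rr Rr' E'') as Ei.
  exact (f_equal (fun z => c (projT1 z) ∘
    fmap F (Some (projT2 z) : @hom (Dcat H) A (sub_dom (proj1_sig (projT1 z))))) Ei).
- exists (zero _ _); split; [reflexivity|discriminate].
Qed.

Definition coproduct_in (A : P) (u : kernelM H A B) : hom (F A) W :=
  proj1_sig (constructive_indefinite_description _ (coproduct_in_ex u)).

Lemma coproduct_in_None (A : P) :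
  coproduct_in (None : kernelM H A B) = zero _ _.
Proof.
unfold coproduct_in; destruct constructive_indefinite_description as [v [E Ev]].
exact (E eq_refl).
Qed.

Lemma coproduct_in_Some (A : P) (u : hom A B) (hu : inMR S u) i
  (r : hom A (sub_dom (proj1_sig i))) (Rr : inR S r) :
  u = sub_mor (proj1_sig i) ∘ r ->
  coproduct_in (Some (exist _ u hu) : kernelM H A B) = c i ∘ fmap F (D_mor Rr).
Proof.
intros E; unfold coproduct_in.
destruct constructive_indefinite_description as [v [E0 Ev]].
apply Ev; simpl; rewrite E; reflexivity.
Qed.

Lemma fmap_D_comp (A A' A'' : P) (s : hom A' A'') (r : hom A A')
  (Rs : inR S s) (Rr : inR S r) :
  fmap F (D_mor Rs) ∘ fmap F (D_mor Rr) =
  fmap F (restr _ (s ∘ r) : @hom (Dcat H) A A'').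
Proof. rewrite <- fmap_comp; reflexivity. Qed.

Lemma coproduct_universal_cowedge :
  universal_cowedge (fun A : Dcat H => @coproduct_in A).
Proof.
split; [split|].
- intros A; apply coproduct_in_None.
- intros A A' [[r Rr]|] [[u hu]|].
  + destruct (inMR_decomp hu) as (i & s & Rs & E).
    rewrite (coproduct_in_Some hu Rs E), <- comp_assoc.
    change (Some (exist _ r Rr)) with (D_mor Rr); rewrite fmap_D_comp; simpl.
    (* [u ∘ r] lies in [inMR] exactly when [s ∘ r] lies in [inR], so the action of [r] on [u] and
       the composite in [D] are zero together. *)
    rewrite comp_id_l; destruct (classic (inMR S (u ∘ r))) as [HM|nM].
    * assert (Rsr : inR S (s ∘ r)).
      { apply (inMR_inR_comp H) with (x := sub_mor (proj1_sig i)); auto.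
        rewrite comp_assoc, <- E; exact HM. }
      rewrite (restr_in HM), (restr_in Rsr).
      apply coproduct_in_Some; rewrite E; symmetry; apply comp_assoc.
    * rewrite (restr_out nM), restr_out.
      { etransitivity; [apply coproduct_in_None|].
        etransitivity; [symmetry; apply zero_r|]; f_equal.
        symmetry; apply zfun_zero. }
      intros Rsr; apply nM; rewrite E, <- comp_assoc.
      apply inMR_comp; [apply sub_in|exact Rsr].
  + etransitivity; [apply coproduct_in_None|].
    rewrite coproduct_in_None, zero_l; reflexivity.
  + etransitivity; [apply coproduct_in_None|].
    etransitivity; [symmetry; apply zero_r|]; f_equal.
    symmetry; apply zfun_zero.
  + etransitivity; [apply coproduct_in_None|].
    rewrite coproduct_in_None, zero_l; reflexivity.
- intros Y j [j0 jr].
  (* [e i] is the subobject [i] itself as an element of [M]. Its map into [W] is the coprojection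
     [c i], so the values of [j] at the [e i] determine [h]. *)
  pose (e i := Some (exist _ _ (inM_inMR (sub_in (proj1_sig i))))
    : kernelM H (sub_dom (proj1_sig (i : {n | In n l}))) B).
  assert (Ee : forall i, coproduct_in (e i) = c i).
  { intros i; etransitivity.
    - apply (coproduct_in_Some (inM_inMR (sub_in (proj1_sig i)))
        (@inR_id P S (sub_dom (proj1_sig i)))).
      rewrite comp_id_r; reflexivity.
    - etransitivity; [|apply comp_id_r].
      apply (f_equal (fun z => c i ∘ z)), (fmap_id F). }
  destruct (Hc (fun i => j _ (e i))) as (h & Eh & uh).
  exists h; split.
  + intros A [[u hu]|].
    * destruct (inMR_decomp hu) as (i & r & Rr & E).
      rewrite (coproduct_in_Some hu Rr E), comp_assoc, Eh, <- jr; f_equal.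
      simpl; rewrite comp_id_l; revert hu; rewrite E; intros hu; apply restr_in.
    * rewrite coproduct_in_None, zero_r; symmetry; apply j0.
  + intros h' Eh'; apply uh; intros i; rewrite <- Eh', Ee; reflexivity.
Qed.

End Coend.

Lemma universal_cowedge_ex (HX : semiabelian X) (F : zfunctor (Dcat H) X)
  (B : P) :
  exists (W : X) (i : forall A : Dcat H, kernelM H A B -> hom (F A) W),
    universal_cowedge i.
Proof.
destruct (sub_finite H B) as [l0 Hl0].
destruct (covers_distinct l0) as (l & Hl & Dl).
assert (Cl : covers l).
{ intros m; destruct (Hl0 m) as (n & Hn & I), (Hl n Hn) as (n' & Hn' & I').
  exists n'; split; [exact Hn'|exact (sub_iso_trans I I')]. }
destruct (proj2 (proj2 HX) { n | In n l } (fun i => F (sub_dom (proj1_sig i)))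
  (finite_sig_In l)) as (W & c & Hc).
exists W, (fun A => coproduct_in Cl Dl c (A := A)).
apply coproduct_universal_cowedge, Hc.
Qed.

(** * Conservativity *)

Lemma normal_iso (HX : semiabelian X) (T U : functor P X) (t : nat_trans T U) :
  (forall (A : P) (Z : X) (y : hom Z (U A)), normal y ->
     exists x, normal x /\ t A ∘ x = y) ->
  (forall (A : P) (Z : X) (x x' : hom Z (T A)), normal x -> normal x' ->
     t A ∘ x = t A ∘ x' -> x = x') ->
  forall A : P, is_iso (t A).
Proof.
intros Hs Hi.
assert (Ind : forall (n : nat) (A : P) (l : list (sub S A)),
  covers l -> length l < n -> is_iso (t A)).
{ induction n as [|n IH]; intros A l Hl Hn; [inversion Hn|].
  destruct (maximal_list_functor A) as (ml & Pml & Oml & Nml).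
  assert (It : forall m, In m ml -> is_iso (t (sub_dom m))).
  { intros m Hm.
    destruct (proper_covers (sub_in m) (Pml m Hm) Hl) as (l' & Hl' & Cl').
    apply (IH _ l' Cl'); eapply PeanoNat.Nat.lt_le_trans; [exact Hl'|].
    apply le_S_n; exact Hn. }
  apply (joint_kernel_iso HX (c := fun m : sub S A => fmap T (idem m))
    (d := fun m => fmap U (idem m)) (l := ml)).
  - intros m; apply naturality.
  - intros m; apply idem_idem.
  - intros m; apply idem_idem.
  - apply Oml.
  - apply Oml.
  - intros m Hm Z y Ey; destruct (It m Hm) as (g & _ & tg).
    exists (fmap T (sub_mor m) ∘ g ∘ fmap U (star (sub_in m)) ∘ y); split.
    + rewrite fmap_idem; crw (fmap_star_mul T m); reflexivity.
    + crw (naturality t (sub_mor m)); crw tg; rewrite <- fmap_comp; exact Ey.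
  - intros m Hm Z x Ex Etx; destruct (It m Hm) as (g & gt & _).
    rewrite <- Ex; apply idem_zero.
    rewrite <- (comp_id_l (fmap T (star (sub_in m)))), <- gt.
    crw (naturality t (star (sub_in m))); rewrite <- comp_assoc, Etx.
    rewrite zero_r; reflexivity.
  - intros Z y Hy; apply Nml in Hy; destruct (Hs A Z y Hy) as (x & Nx & Ex).
    exists x; split; [apply Nml, Nx|exact Ex].
  - intros Z x x' Hx Hx'; apply Hi; apply Nml; assumption. }
intros A; destruct (sub_finite H A) as [l Hl].
exact (Ind _ A l Hl (le_n _)).
Qed.

Lemma tilde_conservative (HX : semiabelian X)
  (Mt : functor (functor_cat P X) (zfunctor_cat (Dcat H) X)) :
  is_tilde (kernelM H) Mt -> conservative Mt.
Proof.
intros HM; destruct (tilde_kernel HM) as (k & kN & km & ku & kt).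
intros T U t (s & s1 & s2); apply pointwise_iso, (normal_iso HX).
- intros A Z y Ny; destruct (ku U A Z y Ny) as [h Eh].
  exists (k T A ∘ (@nt_app (Dcat H) X _ _ s A ∘ h)).
  split; [apply normal_comp, kN|].
  rewrite comp_assoc, <- kt.
  pose proof (f_equal (fun z => @nt_app (Dcat H) X _ _ z A) s2) as E; simpl in E.
  crw E; exact Eh.
- intros A Z x x' Nx Nx' E.
  destruct (ku T A Z x Nx) as [h Eh], (ku T A Z x' Nx') as [h' Eh'].
  pose proof (f_equal (fun z => @nt_app (Dcat H) X _ _ z A) s1) as E1; simpl in E1.
  rewrite <- Eh, <- Eh' in E |- *; f_equal.
  rewrite !comp_assoc, <- kt, <- !comp_assoc in E; apply km in E.
  exact (split_mono E1 E).
Qed.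

(** * Preservation of reflexive coequalizers *)

Lemma normal_kernel_pair_cover (HX : semiabelian X) (T U Q : functor P X)
  (f g : nat_trans T U) (q : nat_trans U Q) (A : P) :
  (forall B, reflexive_pair (f B) (g B)) ->
  (forall B, is_coequalizer (f B) (g B) (q B)) ->
  forall (Z : X) (u v : hom Z (U A)), normal u -> normal v ->
  q A ∘ u = q A ∘ v ->
  exists (Z' : X) (e : hom Z' Z) (x : hom Z' (T A)),
    regular_epi e /\ normal x /\ f A ∘ x = u ∘ e /\ g A ∘ x = v ∘ e.
Proof.
intros Hfg Hq Z u v Nu Nv Euv.
assert (HC : finitely_complete X) by apply HX.
assert (HR : regular X) by apply HX.
destruct (maximal_list_functor A) as (l & _ & Ol & Nl).
destruct (pullback_ex HC (q A) (q A)) as (E & p1 & p2 & HE).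
destruct (pullback_lift (a := f A) (b := g A) HE) as (r & r1 & r2);
  [apply (Hq A)|].
(* The generic element [(p1, p2)] of the kernel pair lifts locally along the comparison [r]. *)
assert (Rr : regular_epi r).
{ destruct (reflexive_coequalizer_cover HX (Hfg A) (Hq A) (proj1 HE))
    as (Z' & e & x & Re & E1 & E2).
  apply (regular_epi_of_factor HR (z := idm E) (z' := e) (x := x)).
  - apply regular_epi_id.
  - exact Re.
  - rewrite comp_id_l; apply (pullback_ext HE); [crw r1|crw r2]; auto. }
(* The idempotents of [U A] act on both components of the kernel pair, which puts [r] in the
   situation of [joint_kernel_cover]. *)
assert (Hd : forall m : sub S A, exists d : hom E E,
  p1 ∘ d = fmap U (idem m) ∘ p1 /\ p2 ∘ d = fmap U (idem m) ∘ p2).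
{ intros m; apply (pullback_lift HE).
  rewrite !comp_assoc, naturality, <- !comp_assoc, (proj1 HE); reflexivity. }
pose (d m := proj1_sig (constructive_indefinite_description _ (Hd m))).
assert (d1 : forall m, p1 ∘ d m = fmap U (idem m) ∘ p1).
{ intros m; apply (proj2_sig (constructive_indefinite_description _ (Hd m))). }
assert (d2 : forall m, p2 ∘ d m = fmap U (idem m) ∘ p2).
{ intros m; apply (proj2_sig (constructive_indefinite_description _ (Hd m))). }
destruct (pullback_lift HE Euv) as (y & y1 & y2).
apply Nl in Nu, Nv.
destruct (joint_kernel_cover HX (c := fun m => fmap T (idem m)) (d := d)
  (f := r)) with (l := l) (y := y) as (Z' & e & x & Re & Kx & Ex).
- intros m; apply (pullback_ext HE).
  + crw r1; crw (d1 m); crw r1; apply naturality.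
  + crw r2; crw (d2 m); crw r2; apply naturality.
- intros m; apply idem_idem.
- exact Rr.
- apply Ol.
- intros m Hm; apply (pullback_ext HE).
  + crw (d1 m); crw y1; rewrite (Nu m Hm), zero_r; reflexivity.
  + crw (d2 m); crw y2; rewrite (Nv m Hm), zero_r; reflexivity.
- exists Z', e, x; split; [exact Re|split; [apply Nl, Kx|]].
  rewrite <- r1, <- r2, <- !comp_assoc, Ex; split; [crw y1|crw y2]; reflexivity.
Qed.

Lemma normal_cover (HX : semiabelian X) (U Q : functor P X) (q : nat_trans U Q)
  (A : P) (Z : X) (y : hom Z (Q A)) :
  regular_epi (q A) -> normal y ->
  exists (Z' : X) (e : hom Z' Z) (x : hom Z' (U A)),
    regular_epi e /\ normal x /\ q A ∘ x = y ∘ e.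
Proof.
intros Rq Ny; destruct (maximal_list_functor A) as (l & _ & Ol & Nl).
destruct (joint_kernel_cover HX (c := fun m : sub S A => fmap U (idem m))
  (d := fun m => fmap Q (idem m)) (f := q A)) with (l := l) (y := y)
  as (Z' & e & x & Re & Kx & Ex).
- intros m; apply naturality.
- intros m; apply idem_idem.
- exact Rq.
- apply Ol.
- apply Nl, Ny.
- exists Z', e, x; split; [exact Re|split; [apply Nl, Kx|exact Ex]].
Qed.

Lemma tilde_preserves_reflexive_coequalizers (HX : semiabelian X)
  (Mt : functor (functor_cat P X) (zfunctor_cat (Dcat H) X)) :
  is_tilde (kernelM H) Mt -> preserves_reflexive_coequalizers Mt.
Proof.
intros HM; destruct (tilde_kernel HM) as (k & kN & km & ku & kt).
assert (HR : regular X) by apply HX.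
intros T U Q f g q Hfg Hq.
pose proof (pointwise_of_coequalizer (reflexive_coequalizers HX) Hfg Hq) as Hp.
(* The zero-preserving functors form a full subcategory, so a coequalizer among all functors on [D]
   suffices, and this can be tested pointwise. *)
assert (HT : is_coequalizer
  (fmap Mt f : @hom (functor_cat (Dcat H) X) (zfun (Mt T)) (zfun (Mt U)))
  (fmap Mt g)
  (fmap Mt q : @hom (functor_cat (Dcat H) X) (zfun (Mt U)) (zfun (Mt Q)))).
{ apply coequalizer_pointwise; intros A; split.
  { exact (f_equal (fun z => @nt_app (Dcat H) X _ _ z A)
      (eq_trans (eq_sym (fmap_comp Mt q f))
        (eq_trans (f_equal (fmap Mt) (proj1 Hq)) (fmap_comp Mt q g)))). }
  intros Y h Eh; apply kernel_pair_coequalizer.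
  (* The generic normal element [k Q A] lifts along [q] on a cover, which makes [Mt q] a regular
     epimorphism at [A]. *)
  - destruct (normal_cover HX (q := q) (A := A) (y := k Q A))
      as (Z & e & x & Re & Nx & Ex).
    + exists (fob T A), (nt_app f A), (nt_app g A); apply Hp.
    + apply kN.
    + destruct (ku U A Z x Nx) as [x' Ex'].
      apply (regular_epi_of_factor HR (z := idm _) (z' := e) (x := x')).
      * apply regular_epi_id.
      * exact Re.
      * rewrite comp_id_l; apply (km Q A).
        rewrite comp_assoc, (kt U Q q A), <- comp_assoc, Ex'; symmetry; exact Ex.
  (* On a cover, [u] and [v] are the images under [Mt f] and [Mt g] of one element [x'], and [h]
     equates these images. *)
  - intros Z u v Euv.
    destruct (normal_kernel_pair_cover HX (f := f) (g := g) (q := q) (A := A))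
      with (u := k U A ∘ u) (v := k U A ∘ v)
      as (Z' & e & x & Re & Nx & E1 & E2).
    + intros B; apply reflexive_pair_pointwise, Hfg.
    + exact Hp.
    + apply normal_comp, kN.
    + apply normal_comp, kN.
    + rewrite !comp_assoc, <- (kt U Q q A), <- !comp_assoc; f_equal; exact Euv.
    + destruct (ku T A Z' x Nx) as [x' Ex'].
      apply (regular_epi_epi Re).
      assert (F1 : nt_app (fmap Mt f : nat_trans _ _) A ∘ x' = u ∘ e).
      { apply (km U A); rewrite comp_assoc, (kt T U f A), <- comp_assoc, Ex', E1.
        symmetry; apply comp_assoc. }
      assert (F2 : nt_app (fmap Mt g : nat_trans _ _) A ∘ x' = v ∘ e).
      { apply (km U A); rewrite comp_assoc, (kt T U g A), <- comp_assoc, Ex', E2.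
        symmetry; apply comp_assoc. }
      rewrite <- !comp_assoc, <- F1, <- F2, !comp_assoc; f_equal; exact Eh. }
split; [exact (proj1 HT)|intros V h Eh; exact (proj2 HT (zfun V) h Eh)].
Qed.

End Kernel.

Theorem theorem8p7 :
  forall (P : category) (S : star_data P) (H : conditions S)
    (X : zcategory) (HX : semiabelian X),
  (exists Mh : functor (zfunctor_cat (Dcat H) X) (functor_cat P X),
     is_hat (kernelM H) Mh) /\
  (exists Mt : functor (functor_cat P X) (zfunctor_cat (Dcat H) X),
     is_tilde (kernelM H) Mt) /\
  (forall (Mh : functor (zfunctor_cat (Dcat H) X) (functor_cat P X))
          (Mt : functor (functor_cat P X) (zfunctor_cat (Dcat H) X)),
     is_hat (kernelM H) Mh -> is_tilde (kernelM H) Mt ->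
     adjoint Mh Mt /\ crudely_monadic Mt).
Proof.
intros P S H X HX; split; [|split].
- exists (hat (universal_cowedge_ex (H := H) HX)); apply hat_is_hat.
- exists (tilde (universal_wedge_ex (H := H) HX)); apply tilde_is_tilde.
- intros Mh Mt HMh HMt; pose proof (hat_tilde_adjoint HMh HMt) as Adj.
  split; [exact Adj|split; [exists Mh; exact Adj|split; [|split]]].
  + exact (tilde_conservative HX HMt).
  + apply functor_cat_reflexive_coequalizers, (reflexive_coequalizers HX).
  + exact (tilde_preserves_reflexive_coequalizers HX HMt).
Qed.
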